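(* Let $(\Omega,\mathcal F,P)$ be a probability space with a filtration $(\mathcal F_t)_{t=0}^T$ such that every set in $\mathcal F_0$ has probability zero or one. For $t=1,\dots,T$, let $K_t:\mathbb R^N\times\mathbb R^M\times\mathbb R^N\times\Omega\to\overline{\mathbb R}$ be an $\mathcal F_t$-measurable lower bounded convex normal integrand and let $J:\mathbb R^N\times\Omega\to\overline{\mathbb R}$ be an $\mathcal F_T$-measurable lower bounded convex normal integrand. Let $((J_t)_{t=0}^T,(\tilde Q_t)_{t=0}^{T-1})$ be a lower bounded convex normal solution of the reduced Bellman equations $$J_T=J,$$ $$\tilde Q_t(X_t,U_t)=\inf_{X_{t+1}\in\mathbb R^N}\{K_{t+1}(X_t,U_t,X_{t+1})+J_{t+1}(X_{t+1})\},\qquad J_t(X_t)=\inf_{U_t\in\mathbb R^M}(E_t\tilde Q_t)(X_t,U_t),\qquad t=0,\dots,T-1.$$ Assume that $K_t$ ($t=1,\dots,T$) depends on $\omega$ only through random variables $(\theta_{t-1},\theta_t,\eta_t)$, where $\theta=(\theta_t)_{t=0}^T$ is an adapted Markov process and $\eta=(\eta_t)_{t=0}^T$ is an adapted sequence of random variables such that each $\eta_t$ is independent of $\theta$ and of $\eta_s$ for $s\ne t$. If $J$ depends on $\omega$ only through $\theta_T$, then $J_t$ depends on $\omega$ only through $\theta_t$. In particular, if $K_t$ and $J$ are independent of $\theta$ (that is, they do not depend on $\theta$), then $J_t$ is deterministic.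
   Context: $\overline{\mathbb R}=[-\infty,+\infty]$. A function $h:\mathbb R^n\times\Omega\to\overline{\mathbb R}$ is a ($\mathcal G$-measurable) normal integrand if $\omega\mapsto\operatorname{epi}h(\cdot,\omega)$ is a closed-valued ($\mathcal G$-)measurable set-valued mapping, i.e. $\{\omega\mid \operatorname{epi}h(\cdot,\omega)\cap O\ne\emptyset\}$ is measurable for every open $O\subset\mathbb R^{n}\times\mathbb R$; it is convex if $h(\cdot,\omega)$ is convex for each $\omega$. It is lower bounded if there is $m\in L^1$ with $h(x,\omega)\ge m(\omega)$ for all $x\in\mathbb R^n$ and almost every $\omega$. The argument $\omega$ is often suppressed. For a sub-$\sigma$-algebra $\mathcal G\subset\mathcal F$, the $\mathcal G$-conditional expectation $E^{\mathcal G}h$ of a lower bounded normal integrand $h$ is the unique $\mathcal G$-measurable normal integrand such that $(E^{\mathcal G}h)(x)=E[h(x)\mid\mathcal G]$ a.s. for every $\mathcal G$-measurable $\mathbb R^n$-valued random variable $x$. $E_t:=E^{\mathcal F_t}$. A lower bounded convex normal solution of the reduced Bellman equations consists of lower bounded convex normal integrands $J_t$ on $\mathbb R^N\times\Omega$ and $\tilde Q_t$ on $\mathbb R^N\times\mathbb R^M\times\Omega$ such that, for almost every $\omega$, the equations hold for all $t$ and all $(X_t,U_t)\in\mathbb R^N\times\mathbb R^M$. Adapted means that the time-$t$ component is $\mathcal F_t$-measurable for each $t$. The random variables $\theta_t$ and $\eta_t$ take values in Euclidean spaces. Given an $\mathbb R^d$-valued random variable $\xi$, a normal integrand $h$ on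 $\mathbb R^n\times\Omega$ depends on $\omega$ only through $\xi$ if there is a normal integrand $H:\mathbb R^n\times\mathbb R^d\to\overline{\mathbb R}$ ($\mathbb R^d$ with its Borel $\sigma$-algebra) such that, almost surely, $h(x,\omega)=H(x,\xi(\omega))$ for all $x\in\mathbb R^n$.
   Formalization: Added assumption: for each t<T, η_{t+1} is independent of F_t and θ jointly (automatic if F is generated by θ and η); without it F_t may reveal future noise and the claim fails, e.g. θ constant, F_1=F_2=σ(η_1,η_2), K_2=η_2, J=0 gives J_1=η_2. *)

(* Defs.v *)
From HB Require Import structures.
From mathcomp Require Import all_boot all_order all_algebra.
From mathcomp Require Import all_classical all_reals all_analysis.
From mathcomp Require Import measurable_realfun.

Set Implicit Arguments.
Unset Strict Implicit.
Unset Printing Implicit Defensive.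

Import Order.TTheory GRing.Theory Num.Theory.
Import numFieldNormedType.Exports.

Local Open Scope classical_set_scope.
Local Open Scope ring_scope.

(* Sub-sigma-algebras are plain set systems [G : set (set Om)]; the Euclidean
   spaces are ['rV[R]_n] and their binary products, all of them normed modules
   carrying the Borel sigma-algebra [borel_sets]. *)

Definition borel_sets (V : topologicalType) : set (set V) := <<s @open V >>.

Definition rv_measurable (Om : pointedType) (V : ptopologicalType)
    (G : set (set Om)) (X : Om -> V) : Prop :=
  measurable_fun setT
    (X : g_sigma_algebraType G -> g_sigma_algebraType (@open V)).

Definition sigma_of (Om : Type) (V : topologicalType) (X : Om -> V) :
    set (set Om) :=
  preimage_set_system setT X (@borel_sets V).

Section normal_integrands.
Context {R : realType} {V : normedModType R}.

Definition epi (f : V -> \bar R) : set (V * R) :=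
  [set p | (f p.1 <= p.2%:E)%E].

(* [Om] is an arbitrary set here, so that the same notion applies both to
   integrands on the probability space and to integrands on R^d. *)
Definition normal_integrand (Om : Type) (G : set (set Om))
    (h : V -> Om -> \bar R) : Prop :=
  (forall w, closed (epi (h ^~ w))) /\
  (forall O : set (V * R), open O -> G [set w | epi (h ^~ w) `&` O !=set0]).

Definition convex_integrand (Om : Type) (h : V -> Om -> \bar R) : Prop :=
  forall w, convex_set (epi (h ^~ w)).

Context {d : measure_display} {Om : measurableType d} (P : probability Om R).

Definition lower_bounded (h : V -> Om -> \bar R) : Prop :=
  exists m : Om -> R, P.-integrable setT (EFin \o m) /\
    {ae P, forall w, forall x, ((m w)%:E <= h x w)%E}.

Definition lb_convex_normal (G : set (set Om)) (h : V -> Om -> \bar R) : Prop :=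
  [/\ normal_integrand G h, convex_integrand h & lower_bounded h].

(* [H] is defined on all of [V * E], not only on the range of [xi]. *)
Definition depends_only_through (E : topologicalType) (h : V -> Om -> \bar R)
    (xi : Om -> E) : Prop :=
  exists H : V -> E -> \bar R, normal_integrand (@borel_sets E) H /\
    {ae P, forall w, forall x, h x w = H x (xi w)}.

Definition deterministic (h : V -> Om -> \bar R) : Prop :=
  exists h0 : V -> \bar R, {ae P, forall w, forall x, h x w = h0 x}.

(* [Z] is a version of E[Y | G]. [Y] need only be bounded below by an integrable
   function: taking A = [Z < 0] shows that the negative part of [Z] is
   integrable, so that [Z] is a.s. unique even where it equals +oo. *)
Definition is_condexp (G : set (set Om)) (Y Z : Om -> \bar R) : Prop :=
  @measurable_fun _ _ (g_sigma_algebraType G) (\bar R) setT Z /\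
  forall A, G A -> (\int[P]_(w in A) Z w = \int[P]_(w in A) Y w)%E.

(* [g] is (a version of) the conditional expectation of the integrand [h]. *)
Definition is_cond_integrand (G : set (set Om)) (h g : V -> Om -> \bar R) :
    Prop :=
  normal_integrand G g /\
  forall X : Om -> V, rv_measurable G X ->
    is_condexp G (fun w => h (X w) w) (fun w => g (X w) w).

End normal_integrands.

Section processes.
Context {R : realType} {d : measure_display} {Om : measurableType d}
        (P : probability Om R).

Definition filtration (T : nat) (F : nat -> set (set Om)) : Prop :=
  [/\ forall t, (t <= T)%N -> sigma_algebra setT (F t),
      forall t, (t <= T)%N -> F t `<=` measurable &
      forall s t, (s <= t)%N -> (t <= T)%N -> F s `<=` F t].

Definition adapted (T : nat) (F : nat -> set (set Om)) (n : nat -> nat)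
    (X : forall t : nat, Om -> 'rV[R]_(n t)) : Prop :=
  forall t, (t <= T)%N -> rv_measurable (F t) (X t).

(* P(X_{t+1} \in B | F_t) = P(X_{t+1} \in B | X_t) a.s.: the two conditional
   probabilities have a common version. *)
Definition adapted_markov (T : nat) (F : nat -> set (set Om)) (n : nat -> nat)
    (X : forall t : nat, Om -> 'rV[R]_(n t)) : Prop :=
  adapted T F X /\
  forall t, (t < T)%N -> forall B, borel_sets B ->
    exists Z : Om -> \bar R,
      is_condexp P (sigma_of (X t)) (EFin \o \1_(X t.+1 @^-1` B)) Z /\
      is_condexp P (F t) (EFin \o \1_(X t.+1 @^-1` B)) Z.

Definition independent (A B : set (set Om)) : Prop :=
  forall a b, A a -> B b -> P (a `&` b) = (P a * P b)%E.

Definition sigma_join (A B : set (set Om)) : set (set Om) := <<s A `|` B >>.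

(* sigma-algebra generated by the X_t with t <= T and [D t] *)
Definition sigma_process (T : nat) (D : set nat) (n : nat -> nat)
    (X : forall t : nat, Om -> 'rV[R]_(n t)) : set (set Om) :=
  <<s \bigcup_(t in [set t | (t <= T)%N /\ D t]) sigma_of (X t) >>.

(* Each [eta t.+1] is independent of [F t] and [theta] jointly. When [F] is the
   filtration generated by [theta] and [eta], this already follows from the
   independence of [eta t] from [theta] and the other [eta s]. For a larger
   filtration it does not: [F t] could reveal [eta t.+1], and conditioning on
   [F t] would then leave a dependence on the noise. *)
Definition innovations (T : nat) (F : nat -> set (set Om)) (n m : nat -> nat)
    (theta : forall t : nat, Om -> 'rV[R]_(n t))
    (eta : forall t : nat, Om -> 'rV[R]_(m t)) : Prop :=
  forall t, (t < T)%N ->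
    independent (sigma_of (eta t.+1))
      (sigma_join (F t) (sigma_process T setT theta)).

End processes.

Section bellman.
Context {R : realType} {d : measure_display} {Om : measurableType d}
        (P : probability Om R).

(* E_t Q_t is given by a version [EQ t]. Since all terms are lower bounded, the
   sum in the first equation is a.s. never of the form -oo + oo. *)
Definition bellman_solution (N M T : nat) (F : nat -> set (set Om))
    (K : nat -> 'rV[R]_N * 'rV[R]_M * 'rV[R]_N -> Om -> \bar R)
    (J : 'rV[R]_N -> Om -> \bar R)
    (Jv : nat -> 'rV[R]_N -> Om -> \bar R)
    (Q : nat -> 'rV[R]_N * 'rV[R]_M -> Om -> \bar R) : Prop :=
  [/\ forall t, (t <= T)%N -> lb_convex_normal P measurable (Jv t),
      forall t, (t < T)%N -> lb_convex_normal P measurable (Q t) &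
      exists EQ : nat -> 'rV[R]_N * 'rV[R]_M -> Om -> \bar R,
        (forall t, (t < T)%N -> is_cond_integrand P (F t) (Q t) (EQ t)) /\
        {ae P, forall w,
          (forall x, Jv T x w = J x w) /\
          (forall t, (t < T)%N ->
            (forall x u, Q t (x, u) w =
               ereal_inf [set (K t.+1 (x, u, y) w + Jv t.+1 y w)%E
                         | y in setT]) /\
            (forall x, Jv t x w =
               ereal_inf [set EQ t (x, u) w | u in setT]))}].

End bellman.

(* Main.v *)
(* A lower semicontinuous integrand h is the supremum, over the sets O of a
   countable base that contain x, of the functions inf_O h. Conversely, any
   countable family (b_O) of measurable functions generates in this way a normal
   integrand: on a compact set D, the event that the supremum exceeds a at every
   point of D is a countable union over the finite subcovers S of D of the
   events [b_O > a for all O in S]. So "h depends on omega only through xi"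
   is a property of the functions inf_O h, and it passes to sums and to partial
   infima.

   Conditional expectation: by the Markov property, the independence of the
   noise and a pi-lambda argument, every nonnegative function of
   xi = (theta_t, theta_(t+1), eta_(t+1)) has a version of its F_t-conditional
   expectation that is a function of theta_t. Let gamma be the integrand
   generated by the F_t-conditional expectations of inf_O Q, with O running over
   the finite intersections of basic sets. Monotone convergence along the basic
   neighbourhoods of X gives gamma(X) = E[Q(X) | F_t] for every F_t-measurable
   X, and a measurable selection then shows that gamma and E_t Q agree almost
   surely at all arguments. Backward induction concludes; when theta is absent,
   the same argument is run with a constant process in place of theta. *)
Require Import Defs.
From HB Require Import structures.
From mathcomp Require Import all_boot all_order all_algebra.
From mathcomp Require Import finmap.
From mathcomp Require Import all_classical all_reals all_analysis.
From mathcomp Require Import measurable_realfun.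

Set Implicit Arguments.
Unset Strict Implicit.
Unset Printing Implicit Defensive.

Import Order.TTheory GRing.Theory Num.Theory.
Import numFieldNormedType.Exports.

Local Open Scope classical_set_scope.
Local Open Scope ring_scope.

(* Mathcomp-analysis does not declare products as [ptopologicalType]s. *)
HB.saturate prod.

(** * Compact bases and measurability *)

(** A countable family with two uses: the interiors of its members form a countable open base, and
    the compactness of the members yields finite subcovers and measurable selections. *)
Definition compact_base (V : topologicalType) (C : nat -> set V) : Prop :=
  (forall n, compact (C n)) /\
  forall (x : V) (U : set V), nbhs x U -> exists n, nbhs x (C n) /\ C n `<=` U.

(** The closed cubes with rational centres and half-sides 1/(k+1) serve; an index that decodes to no
    pair gives the empty set. *)
Lemma compact_base_rV (R : realType) (n : nat) :
  exists C : nat -> set 'rV[R]_n, compact_base C.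
Proof.
pose cube (q : 'rV[rat]_n) (k : nat) : set 'rV[R]_n :=
  [set v | forall i, `[ratr (q ord0 i) - k.+1%:R^-1,
                       ratr (q ord0 i) + k.+1%:R^-1]%classic (v ord0 i)].
exists (fun m =>
  if (choice.unpickle m : option ('rV[rat]_n * nat)) is Some (q, k)
  then cube q k else set0); split.
  move=> m; case: choice.unpickle => [[q k]|]; last exact: compact0.
  apply: (@rV_compact R n (fun i => `[ratr (q ord0 i) - k.+1%:R^-1,
    ratr (q ord0 i) + k.+1%:R^-1]%classic)) => i.
  exact: segment_compact.
move=> x U /nbhs_ballP[e /= e0 xeU].
(* With a centre within 1/(2(k+1)) of [x], the cube contains the ball of that radius about [x], and
   its points are within 1/(2(k+1)) + 1/(k+1) < e of [x]. *)
have [k ke] : exists k : nat, k.+1%:R^-1 < e / 2.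
  have e20 : 0 < e / 2 by rewrite divr_gt0.
  have [k ke] := ltr_add_invr (e20 : 0 < e / 2).
  by exists k; rewrite add0r in ke.
have k0 : 0 < k.+1%:R^-1 :> R by rewrite invr_gt0.
have [q qP] : exists q : 'rV[rat]_n, forall i,
    `|x ord0 i - ratr (q ord0 i)| < k.+1%:R^-1 / 2.
  have H i : exists r : rat, `|x ord0 i - ratr r| < k.+1%:R^-1 / 2.
    have : x ord0 i - k.+1%:R^-1 / 2 < x ord0 i + k.+1%:R^-1 / 2.
      by rewrite ltrD2l gtrN// divr_gt0.
    move=> /rat_in_itvoo[r]; rewrite in_itv/= => /andP[r1 r2]; exists r.
    by rewrite ltr_distlC r1 r2.
  have [f fP] := choice H.
  by exists (\row_i f i) => i; rewrite mxE.
exists (choice.pickle (q, k)); rewrite choice.pickleK; split.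
  apply/nbhs_ballP; exists (k.+1%:R^-1 / 2) => /=; first by rewrite divr_gt0.
  move=> y [_ /= xy] i; rewrite /= in_itv/=.
  rewrite -ler_distlC.
  have := ler_distD (x ord0 i) (ratr (q ord0 i)) (y ord0 i).
  move=> /le_trans; apply.
  rewrite [leRHS]splitr lerD// ?ltW//; first by rewrite distrC.
  by have := xy ord0 i; rewrite /ball/=.
move=> y qy; apply: xeU; split => // i j; rewrite (ord1 i) /ball/=.
have := ler_distD (ratr (q ord0 j)) (x ord0 j) (y ord0 j).
move=> /le_lt_trans; apply; rewrite [ltRHS]splitr ltr_leD//.
  apply: (lt_trans (qP j)); apply: (lt_trans _ ke).
  by rewrite ltr_pdivrMr// ltr_pMr// ltr1n.
apply: le_trans (ltW ke); rewrite ler_distlC.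
by have := qy j; rewrite /= in_itv.
Qed.

Lemma compact_base_prod (V W : topologicalType) (C : nat -> set V)
    (D : nat -> set W) : compact_base C -> compact_base D ->
  exists E : nat -> set (V * W), compact_base E.
Proof.
move=> [cC bC] [cD bD].
exists (fun m => if (choice.unpickle m : option (nat * nat)) is Some (i, j)
        then C i `*` D j else set0); split.
  move=> m; case: choice.unpickle => [[i j]|]; last exact: compact0.
  exact: compact_setX.
move=> [x y] U [[A B] /= [xA yB] ABU].
have [i [xi iA]] := bC _ _ xA; have [j [yj jB]] := bD _ _ yB.
exists (choice.pickle (i, j)); rewrite choice.pickleK; split.
  by exists (C i, D j).
by move=> [u v] [/= /iA ? /jB ?]; apply: ABU.
Qed.

Lemma interior_base (V : topologicalType) (C : nat -> set V) :
  compact_base C -> forall (x : V) (U : set V), nbhs x U ->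
  exists n, (C n)^° x /\ (C n)^° `<=` U.
Proof.
move=> [_ bC] x U /bC[n [nx nU]]; exists n; split => //.
by move=> y /interior_subset/nU.
Qed.

Section measurability.
Context {d : measure_display} {T : measurableType d} {R : realType}.
Local Open Scope ereal_scope.

Lemma emeasurable_lt (f : T -> \bar R) :
  (forall a : R, measurable [set w | f w < a%:E]) -> measurable_fun setT f.
Proof.
move=> mf; apply: (measurability _ (ErealGenInftyO.measurableE R)).
move=> _ [_ [r ->] <-]; rewrite setTI.
rewrite (_ : _ @^-1` _ = [set w | f w < r%:E]); first exact: mf.
by apply/seteqP; split => w /=; rewrite in_itv.
Qed.

Lemma emeasurable_gt (f : T -> \bar R) :
  (forall a : R, measurable [set w | a%:E < f w]) -> measurable_fun setT f.
Proof.
move=> mf; apply: (measurability _ (ErealGenOInfty.measurableE R)).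
move=> _ [_ [r ->] <-]; rewrite setTI.
rewrite (_ : _ @^-1` _ = [set w | r%:E < f w]); first exact: mf.
by apply/seteqP; split => w /=; rewrite in_itv/= andbT.
Qed.

Lemma measurable_lt (f : T -> \bar R) (a : \bar R) :
  measurable_fun setT f -> measurable [set w | f w < a].
Proof.
by move=> /(emeasurable_fun_infty_o measurableT)/(_ a); rewrite setTI.
Qed.

Lemma measurable_gt (f : T -> \bar R) (a : \bar R) :
  measurable_fun setT f -> measurable [set w | a < f w].
Proof.
by move=> /(emeasurable_fun_o_infty measurableT)/(_ a); rewrite setTI.
Qed.

Lemma measurable_bigcup_count (I : countType) (A : set I) (F : I -> set T) :
  (forall i, A i -> measurable (F i)) -> measurable (\bigcup_(i in A) F i).
Proof.
move=> mF; rewrite bigcup_mkcond; apply: countable_bigcupT_measurable => // i.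
by case: ifPn => // /set_mem; exact: mF.
Qed.

Lemma measurable_sup (I : countType) (f : I -> T -> \bar R) :
  (forall i, measurable_fun setT (f i)) ->
  measurable_fun setT (fun w => ereal_sup (range (f ^~ w))).
Proof.
move=> mf; apply: emeasurable_gt => a.
rewrite (_ : [set w | _] = \bigcup_i [set w | a%:E < f i w]).
  by apply: countable_bigcupT_measurable => // i; exact: measurable_gt.
apply/seteqP; split => w /=.
  by move=> /ereal_sup_gt[_ [i _ <-] ai]; exists i.
move=> [i _ /= ai]; apply: (lt_le_trans ai).
by apply: ereal_sup_ubound; exists i.
Qed.

End measurability.

(** * Integrands generated by countable families *)

Section ereal_lemmas.
Context {R : realType}.
Local Open Scope ereal_scope.

Lemma ereal_rat_between (x y : \bar R) : x < y ->
  exists q : rat, x < (ratr q)%:E /\ (ratr q)%:E < y.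
Proof.
have itv (a b : R) : (a < b)%R ->
    exists q : rat, (a < ratr q)%R /\ (ratr q < b)%R.
  by move=> /rat_in_itvoo[q]; rewrite in_itv/= => /andP[]; exists q.
case: x => [x| |]; case: y => [y| |] //=.
- by rewrite lte_fin => /itv[q [? ?]]; exists q; rewrite !lte_fin.
- move=> _; have [|q [? ?]] := itv x (x + 1)%R; first by rewrite ltrDl.
  by exists q; rewrite lte_fin ltry.
- move=> _; have [|q [? ?]] := itv (y - 1)%R y; first by rewrite gtrBl.
  by exists q; rewrite lte_fin ltNyr.
- by move=> _; exists 0%R; rewrite ltNyr ltry.
Qed.

Lemma ereal_real_between (x : \bar R) (a : R) : x < a%:E ->
  exists r : R, x <= r%:E /\ (r < a)%R.
Proof.
by move=> /ereal_rat_between[q [/ltW ? ?]]; exists (ratr q); rewrite -lte_fin.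
Qed.

Lemma ereal_inf_subset (T : Type) (A B : set T) (f : T -> \bar R) :
  A `<=` B -> ereal_inf [set f x | x in B] <= ereal_inf [set f x | x in A].
Proof.
by move=> AB; apply: ereal_inf_le_tmp => _ [x /AB Bx <-]; exists x.
Qed.

End ereal_lemmas.

Lemma open_setX (U V : topologicalType) (A : set U) (B : set V) :
  open A -> open B -> open (A `*` B).
Proof.
move=> oA oB; rewrite openE => -[x y] [/= Ax By].
by exists (A, B) => //=; split; apply: open_nbhs_nbhs.
Qed.

Section normal_representation.
Context {R : realType} {V : normedModType R}.
Local Open Scope ereal_scope.

(** A closed epigraph encodes lower semicontinuity. If a rational q lay strictly between the
    supremum and [f x], a box around [(x, q)] would miss the epigraph, so [f] would stay at least q
    on some [O k] containing [x]. *)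
Lemma lsc_sup_inf (I : Type) (O : I -> set V) (f : V -> \bar R) (x : V) :
    (forall (x : V) U, nbhs x U -> exists k, O k x /\ O k `<=` U) ->
    closed (epi f) ->
  f x = ereal_sup [set ereal_inf [set f y | y in O k] | k in [set k | O k x]].
Proof.
move=> bO cf; apply/eqP; rewrite eq_le; apply/andP; split; last first.
  apply: ge_ereal_sup => _ [k /= Okx <-].
  by apply: ereal_inf_lbound; exists x.
rewrite leNgt; apply/negP => /ereal_rat_between[q [sq qf]].
have : nbhs (x, ratr q : R) (~` epi f).
  apply: open_nbhs_nbhs; split; first exact: closed_openC.
  by rewrite /epi /= => /(lt_le_trans qf); rewrite ltxx.
move=> [[A B] /= [xA qB] AB].
have [k [Okx OkA]] := bO _ _ xA.
suff : (ratr q)%:E <= ereal_inf [set f y | y in O k].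
  move=> qi; move: sq; rewrite ltNge => /negP; apply.
  by apply: (le_trans qi); apply: ereal_sup_ubound; exists k.
apply: le_ereal_inf_tmp => _ [y Oky <-]; rewrite leNgt; apply/negP => yq.
apply: (AB (y, ratr q)); last exact: ltW.
by split => /=; [exact: OkA|exact: nbhs_singleton].
Qed.

(** The complement of the epigraph is the union of the open sets [O k] times the open half-line
    below [b k]. *)
Lemma closed_epi_sup (I : Type) (O : I -> set V) (b : I -> \bar R) :
  (forall k, open (O k)) ->
  closed (epi (fun x => ereal_sup [set b k | k in [set k | O k x]])).
Proof.
move=> oO; rewrite -[epi _]setCK; apply: open_closedC.
rewrite (_ : ~` _ = \bigcup_k (O k `*` [set r | r%:E < b k])).
  apply: bigcup_open => k _; apply: open_setX => //.
  rewrite openE => r /= /ereal_rat_between[q []]; rewrite lte_fin => rq qb.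
  apply: filterS (lt_nbhsl rq) => s /= sq.
  by apply: lt_trans qb; rewrite lte_fin.
apply/seteqP; split => [[x r] /= |[x r] [k _ [/= Okx rb]]].
  rewrite /epi/= => /negP; rewrite -ltNge => /ereal_sup_gt[_ [k ? <-]].
  by exists k.
rewrite /epi/= leNgt => /negP; apply; apply: (lt_le_trans rb).
by apply: ereal_sup_ubound; exists k.
Qed.

Context {d : measure_display} {T : measurableType d}.

(** The infimum is below [a] exactly when the epigraph meets the open set [O] times the half-line
    below [a]. *)
Lemma measurable_inf_open (h : V -> T -> \bar R) (O : set V) :
  normal_integrand measurable h -> open O ->
  measurable_fun setT (fun w => ereal_inf [set h x w | x in O]).
Proof.
move=> [_ hN] oO; apply: emeasurable_lt => a.
rewrite (_ : [set w | _] =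
  [set w | epi (h ^~ w) `&` (O `*` [set r | (r < a)%R]) !=set0]).
  apply: hN; apply: open_setX => //; exact: open_lt.
apply/seteqP; split => w /=.
  move=> /ereal_inf_lt[_ [x Ox <-] /ereal_real_between[r [? ?]]].
  by exists (x, r).
move=> [[x r] [/= xr [/= Ox ra]]].
apply: (@le_lt_trans _ _ (h x w)); first by apply: ereal_inf_lbound; exists x.
by apply: (le_lt_trans xr); rewrite lte_fin.
Qed.

Lemma measurable_sup_gt_compact (I : countType) (O : I -> set V)
    (b : I -> T -> \bar R) (D : set V) (a : R) :
  (forall k, open (O k)) -> (forall k, measurable_fun setT (b k)) ->
  compact D ->
  measurable [set w | forall x, D x ->
    a%:E < ereal_sup [set b k w | k in [set k | O k x]]].
Proof.
move=> oO mb cD.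
rewrite (_ : [set w | _] = \bigcup_(S in [set S : {fset I} |
    D `<=` \bigcup_(k in [set` S]) O k])
    \bigcap_(k in [set` S]) [set w | a%:E < b k w]).
  apply: measurable_bigcup_count => S _; apply: fin_bigcap_measurable => // k _.
  exact: measurable_gt.
apply/seteqP; split => w /=.
  move=> aD; move: cD; rewrite compact_cover => /(_ I [set k | a%:E < b k w] O).
  case=> //.
    by move=> x /aD/ereal_sup_gt[_ [k ? <-]] ?; exists k.
  move=> S SD DS; exists S => // k kS /=.
  by have := SD _ kS; rewrite inE.
move=> [S /= DS aS] x /DS[k /= kS Okx].
by apply: (lt_le_trans (aS k kS)); apply: ereal_sup_ubound; exists k.
Qed.

Lemma measurable_level_compact_sup (I : countType) (O : I -> set V)
    (b : I -> T -> \bar R) (D : set V) (a : R) :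
  (forall k, open (O k)) -> (forall k, measurable_fun setT (b k)) ->
  compact D ->
  measurable [set w | exists x, D x /\
    ereal_sup [set b k w | k in [set k | O k x]] <= a%:E].
Proof.
move=> oO mb cD.
have := measurable_sup_gt_compact a oO mb cD => /measurableC.
congr (measurable _); apply/seteqP; split => w /=.
  apply: contra_notP => /forallNP H x Dx; rewrite ltNge; apply/negP => ?.
  exact: (H x).
by move=> [x [Dx xa]] /(_ _ Dx); rewrite ltNge xa.
Qed.

Variable C : nat -> set V.
Hypothesis bC : compact_base C.

Lemma normal_sup (I : countType) (O : I -> set V) (b : I -> T -> \bar R) :
  (forall k, open (O k)) -> (forall k, measurable_fun setT (b k)) ->
  normal_integrand measurable
    (fun x w => ereal_sup [set b k w | k in [set k | O k x]]).
Proof.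
move=> oO mb; split; first by move=> w; exact: closed_epi_sup.
move=> U oU.
pose f x w := ereal_sup [set b k w | k in [set k | O k x]].
rewrite -/f.
(* Epigraphs are closed upwards, so a point of the epigraph in the open set [U] can be raised to a
   rational height and its argument enclosed in some [C n] without leaving [U]. Hitting [U] thus
   reduces to countably many level tests on compact sets. *)
pose box := [set p : nat * rat | forall x, C p.1 x -> U (x, ratr p.2)].
rewrite (_ : [set w | _] = \bigcup_(p in box)
    [set w | exists x, C p.1 x /\ f x w <= (ratr p.2)%:E]).
  apply: measurable_bigcup_count => p _.
  by apply: measurable_level_compact_sup => //; exact: bC.1.
apply/seteqP; split => w /=.
  move=> [[x r] [/= xr Uxr]].
  have [[A B] /= [xA rB] AB] : nbhs (x, r) U by apply: open_nbhs_nbhs.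
  have [n [nx nA]] := bC.2 _ _ xA.
  have [e /= e0 eB] := (nbhs_ballP _ _).1 rB.
  have [q] : exists q : rat, (r < ratr q)%R /\ (ratr q < r + e)%R.
    have /rat_in_itvoo[q] : (r < r + e)%R by rewrite ltrDl.
    by rewrite in_itv/= => /andP[]; exists q.
  move=> [rq qe]; exists (n, q).
    move=> y /= Cy; apply: AB; split => /=; first exact: nA.
    by apply: eB; rewrite /ball/= distrC ger0_norm ?subr_ge0 ?ltW// ltrBlDl.
  exists x; split; first exact: nbhs_singleton.
  by apply: (le_trans xr); rewrite lee_fin ltW.
by move=> [[n q] /= bx [x [Cx fx]]]; exists (x, ratr q); split => //; exact: bx.
Qed.

Lemma normal_sup_inf (h : V -> T -> \bar R) (x : V) (w : T) :
  closed (epi (h ^~ w)) ->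
  h x w = ereal_sup [set ereal_inf [set h y w | y in (C k)^°] |
                     k in [set k | (C k)^° x]].
Proof.
by move=> ch; apply: (lsc_sup_inf (f := h ^~ w)) => //; exact: interior_base.
Qed.

(** [h] is generated by its own infima over the interiors of the base, and these are measurable. *)
Lemma measurable_level_compact (h : V -> T -> \bar R) (D : set V) (a : R) :
  normal_integrand measurable h -> compact D ->
  measurable [set w | exists x, D x /\ h x w <= a%:E].
Proof.
move=> hN cD.
have := @measurable_level_compact_sup _ (fun k => (C k)^°)
  (fun k w => ereal_inf [set h x w | x in (C k)^°]) D a
  (fun k => open_interior _)
  (fun k => measurable_inf_open hN (@open_interior _ _)) cD.
congr (measurable _); apply/seteqP; split => w [x [Dx]].
  by rewrite -normal_sup_inf; [exists x|exact: hN.1].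
by rewrite (@normal_sup_inf h x w); [exists x|exact: hN.1].
Qed.

End normal_representation.

(** * Measurable selections *)

Section selection.
Context {R : realType} {V : normedModType R}.
Variable C : nat -> set V.
Hypothesis bC : compact_base C.
Context {d : measure_display} {T : measurableType d}.
Variable h : V -> T -> \bar R.
Hypothesis hN : normal_integrand measurable h.
Variables (D : set V) (a : R).
Hypothesis cD : compact D.

Let level (w : T) : set V := [set x | (h x w <= a%:E)%E].

(* Bisection: among the points of [D] at level [a], keep those in [C n]
   whenever there are some; since [C] separates points, a single one remains. *)
Fixpoint bisect (n : nat) (w : T) : set V :=
  if n is m.+1 then
    if pselect (bisect m w `&` C m `&` level w !=set0)
    then bisect m w `&` C m else bisect m w
  else D.

Let closedC n : closed (C n).
Proof. by apply: compact_closed (bC.1 n); exact: norm_hausdorff. Qed.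

Let level_closed w : closed (level w).
Proof.
rewrite (_ : level w = (fun x => (x, a)) @^-1` epi (h ^~ w))//.
apply: preimage_closed; last exact: hN.1.
move=> x _; apply: (@cvg_pair _ _ _ _ (nbhs x) (nbhs a)) => //.
exact: cvg_cst.
Qed.

Let bisect_compact n w : compact (bisect n w).
Proof.
elim: n => [|n IH] //=; case: pselect => ? //.
exact: compact_closedI.
Qed.

Let bisect_le m n w : (m <= n)%N -> bisect n w `<=` bisect m w.
Proof.
elim: n => [|n IH]; first by rewrite leqn0 => /eqP ->.
rewrite leq_eqVlt => /predU1P[->//|/IH mn] x /=; case: pselect => ? //=.
  by move=> [/mn].
exact: mn.
Qed.

Let bisect_level n w : D `&` level w !=set0 -> bisect n w `&` level w !=set0.
Proof. by move=> Dw; elim: n => [|n IH] //=; case: pselect. Qed.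

(** The induction runs over all closed [A] at once: when a bisection step keeps [C n], the test set
    changes from [A] to its intersection with [C n]. *)
Let measurable_bisect n (A : set V) : closed A ->
  measurable [set w | bisect n w `&` A `&` level w !=set0].
Proof.
elim: n A => [|n IH] A cA.
  rewrite (_ : [set w | _] =
      [set w | exists x, (D `&` A) x /\ (h x w <= a%:E)%E]).
    by have := measurable_level_compact bC a hN (compact_closedI cD cA).
  by apply/seteqP; split => w [x [? ?]]; exists x.
rewrite (_ : [set w | _] =
    [set w | bisect n w `&` C n `&` level w !=set0] `&`
    [set w | bisect n w `&` (C n `&` A) `&` level w !=set0] `|`
    ~` [set w | bisect n w `&` C n `&` level w !=set0] `&`
    [set w | bisect n w `&` A `&` level w !=set0]).
  apply: measurableU; apply: measurableI.
  - exact: IH.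
  - by apply: IH; exact: closedI.
  - by apply: measurableC; exact: IH.
  - exact: IH.
apply/seteqP; split => w /=; case: pselect => H /=.
- by rewrite -(setIA (bisect n w) (C n) A) => H1; exact: or_introl (conj H H1).
- by move=> H1; exact: or_intror (conj H H1).
- by rewrite -(setIA (bisect n w) (C n) A) => -[[_ ?]//|[/(_ H)]].
- by move=> [[/H]|[_ ?]].
Qed.

Lemma measurable_selection : exists X : T -> V,
  measurable_fun setT (X : T -> g_sigma_algebraType (@open V)) /\
  forall w, D `&` level w !=set0 -> D (X w) /\ (h (X w) w <= a%:E)%E.
Proof.
(* The sets kept by the bisection decrease; cut with the level set they are closed, nonempty and
   inside the compact [D], so they have a common point. *)
have ex w : D `&` level w !=set0 -> \bigcap_n (bisect n w `&` level w) !=set0.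
  move=> Dw.
  have := cD; rewrite compact_In0.
  move=> /(_ nat setT (fun n => bisect n w `&` level w)).
  apply.
    exists (fun n => bisect n w `&` level w) => n _.
      apply: closedI => //.
      by apply: compact_closed => //; exact: norm_hausdorff.
    by rewrite setIA (_ : D `&` _ = bisect n w)// setIidr//; exact: (@bisect_le 0).
  move=> S _; have [n nS] : exists n, forall i, i \in S -> (i <= n)%N.
    exists (\max_(i <- enum_fset S) i)%N => i iS.
    exact: (@leq_bigmax_seq _ (enum_fset S) xpredT id i iS isT).
  have [x [nx lx]] := bisect_level n Dw; exists x => i /= iS; split => //.
  by apply: bisect_le nx; exact: nS.
(* The default value 0 is taken where [D] misses the level set; it accounts for the last term of the
   preimage computed below. *)
pose X w : V := xget 0 (\bigcap_n (bisect n w `&` level w)).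
have XP w : D `&` level w !=set0 -> (\bigcap_n (bisect n w `&` level w)) (X w).
  by move=> /ex; rewrite /X => -[x xP]; exact: xgetI xP.
have mD : measurable [set w | D `&` level w !=set0].
  rewrite (_ : [set w | _] = [set w | bisect 0 w `&` setT `&` level w !=set0]).
    exact: measurable_bisect closedT.
  by apply/seteqP; split => w /=; rewrite setIT.
exists X; split; last by move=> w /XP/(_ 0%N I)[].
(* Step [n] of the bisection decides whether the selected point lies in [C n]: if the test succeeds
   only points of [C n] are kept, otherwise no candidate lies in [C n]. *)
have XC n w : D `&` level w !=set0 ->
    C n (X w) <-> bisect n w `&` C n `&` level w !=set0.
  move=> Dw; have [bX lX] := XP w Dw n I; split => [CX|H]; first by exists (X w).
  have [] := XP w Dw n.+1 I; rewrite /=; case: pselect => // ?.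
  by move=> [].
apply: (@measurability _ _ _ (g_sigma_algebraType (@open V)) _ _ (@open V)) => //.
move=> _ [U oU <-]; rewrite setTI; pose U' : set V := U.
have X0 w : ~ (D `&` level w !=set0) -> X w = 0.
  move=> Dw; apply: xgetPN => x xP; apply: Dw.
  by exists x; exact: (xP 0%N I).
rewrite (_ : X @^-1` U =
    (\bigcup_(n in [set n | C n `<=` U'])
      ([set w | D `&` level w !=set0] `&`
       [set w | bisect n w `&` C n `&` level w !=set0])) `|`
    (~` [set w | D `&` level w !=set0] `&` [set w | U' 0])).
  apply: measurableU.
    apply: bigcup_measurable => n _; apply: measurableI => //.
    exact: measurable_bisect.
  apply: measurableI; first exact: measurableC.
  have [U0|U0] := pselect (U' 0).
    by rewrite (_ : [set w | _] = setT)//; apply/seteqP; split.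
  by rewrite (_ : [set w | _] = set0)//; apply/seteqP; split.
apply/seteqP; split => w /=.
  move=> UX; have [Dw|Dw] := pselect (D `&` level w !=set0); last first.
    by right; rewrite -(X0 w Dw).
  have [n [nX nU]] := bC.2 _ _ (open_nbhs_nbhs (conj oU UX)).
  left; exists n => //; split => //=; apply/(XC n w Dw).
  exact: nbhs_singleton.
by move=> [[n nU [/= Dw /(XC n w Dw)/nU]]|[/X0 -> U0]].
Qed.

End selection.

(** * Almost sure uniqueness of normal integrands *)

Lemma ae_forall_count {d : measure_display} {T : measurableType d}
    {R : realType} (mu : measure T R) (I : countType) (P : I -> T -> Prop) :
  (forall i, {ae mu, forall w, P i w}) -> {ae mu, forall w, forall i, P i w}.
Proof.
move=> aeP.
have : {ae mu, forall w, forall n : nat,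
    if choice.unpickle n is Some i then P i w else True}.
  apply: ae_foralln => n.
  by case: choice.unpickle => [i|]; [exact: aeP|exact: aeW].
by apply: filterS => w Pw i; have := Pw (choice.pickle i); rewrite choice.pickleK.
Qed.

Section uniqueness.
Context {R : realType} {V : normedModType R} {d : measure_display}
  {Om : measurableType d} (P : probability Om R).
Variables (C : nat -> set V) (G : set (set Om)).
Hypothesis bC : compact_base C.
Hypothesis sG : sigma_algebra setT G.
Local Open Scope ereal_scope.

(** The null set in the hypothesis depends on [X]. Measurable selections from the level sets of [g]
    on [C n] at rational heights are countably many choices of [X], which leaves a single null set
    for all arguments. *)
Lemma normal_integrand_ae_eq (g h : V -> Om -> \bar R) :
    normal_integrand G g -> normal_integrand G h ->
    (forall X : Om -> V, rv_measurable G X ->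
      {ae P, forall w, g (X w) w = h (X w) w}) ->
  {ae P, forall w, forall x, g x w = h x w}.
Proof.
wlog suff half : g h / normal_integrand G g -> normal_integrand G h ->
    (forall X : Om -> V, rv_measurable G X ->
      {ae P, forall w, g (X w) w = h (X w) w}) ->
    {ae P, forall w, forall x, h x w <= g x w}.
  move=> gN hN gh; have hg X : rv_measurable G X ->
      {ae P, forall w, h (X w) w = g (X w) w}.
    by move=> /gh; apply: filterS => w ->.
  have := half _ _ gN hN gh; have := half _ _ hN gN hg.
  by apply: filterS2 => w H1 H2 x; apply/eqP; rewrite eq_le H1 H2.
move=> gN hN gh.
have GE : (measurable : set (set (g_sigma_algebraType G))) = G.
  exact: sigma_algebra_id.
have gN' : @normal_integrand _ _ (g_sigma_algebraType G) measurable g.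
  by rewrite GE.
have level (n : nat) (q : rat) : {ae P, forall w,
    (exists x, C n x /\ g x w <= (ratr q)%:E) ->
    exists x, C n x /\ h x w <= (ratr q)%:E}.
  have [X [mX XP]] := measurable_selection bC gN' (ratr q) (bC.1 n).
  apply: filterS (gh X mX) => w gX [x [Cx gx]].
  have [CX gXq] := XP w (ex_intro _ x (conj Cx gx)).
  by exists (X w); rewrite -gX.
have : {ae P, forall w, forall nq : nat * rat,
    (exists x, C nq.1 x /\ g x w <= (ratr nq.2)%:E) ->
    exists x, C nq.1 x /\ h x w <= (ratr nq.2)%:E}.
  by apply: ae_forall_count => -[n q]; exact: level.
(* Suppose g x < q < h x. By lower semicontinuity [h] stays above q on some [C n] around [x]; yet
   [g] reaches level q on [C n], so [h] must do so too. *)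
apply: filterS => w gh' x; rewrite leNgt; apply/negP.
move=> /ereal_rat_between[q [gq qh]].
have hE := lsc_sup_inf x (interior_base bC) (hN.1 w).
move: qh; rewrite hE => /ereal_sup_gt[_ [k /= Ckx <-] qk].
have [n [nx nk]] : exists n, nbhs x (C n) /\ C n `<=` (C k)^°.
  by apply: bC.2; apply: open_nbhs_nbhs; split => //; exact: open_interior.
have [|y [/nk Cky hyq]] := gh' (n, q).
  by exists x; split; [exact: nbhs_singleton|exact: ltW].
suff : (ratr q)%:E < h y w by rewrite ltNge hyq.
by apply: (lt_le_trans qk); apply: ereal_inf_lbound; exists y.
Qed.

End uniqueness.

(** * Conditional expectations *)

Section condexp.
Context {R : realType} {d : measure_display} {Om : measurableType d}
  (P : probability Om R).
Variable G : set (set Om).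
Hypothesis sG : sigma_algebra setT G.
Hypothesis Gm : G `<=` measurable.
Local Open Scope ereal_scope.
Local Notation GOm := (g_sigma_algebraType G).
Implicit Types Y Z : Om -> \bar R.

(** Nonnegativity at every point makes sums, monotone limits and comparisons available even where
    the values are +oo. *)
Definition nncondexp (Y Z : Om -> \bar R) : Prop :=
  [/\ measurable_fun setT Y, measurable_fun setT (Z : GOm -> \bar R),
      forall w, 0 <= Y w, forall w, 0 <= Z w &
      forall A, G A -> \int[P]_(w in A) Z w = \int[P]_(w in A) Y w].

Lemma measurable_sigmaE : (measurable : set (set GOm)) = G.
Proof. exact: sigma_algebra_id. Qed.

Lemma measurable_fun_sub d' (U : measurableType d') (f : Om -> U) :
  measurable_fun setT (f : GOm -> U) -> measurable_fun setT f.
Proof.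
move=> mf _ B mB; apply: Gm; rewrite -measurable_sigmaE; exact: mf.
Qed.

(** For rationals q < r let A be the event Z2 < q, Z1 > r. It belongs to [G], so r P(A) <= E[Z1; A]
    <= E[Z2; A] <= q P(A), which forces P(A) = 0. The two rationals replace the difference of Z1 and
    Z2, which may be of the form +oo - oo. *)
Lemma nncondexp_le Y1 Y2 Z1 Z2 : nncondexp Y1 Z1 -> nncondexp Y2 Z2 ->
  {ae P, forall w, Y1 w <= Y2 w} -> {ae P, forall w, Z1 w <= Z2 w}.
Proof.
move=> [mY1 mZ1 Y10 Z10 YZ1] [mY2 mZ2 Y20 Z20 YZ2] Y12.
suff : {ae P, forall w, forall qr : rat * rat, (qr.1 < qr.2)%R ->
    ~ (Z2 w < (ratr qr.1)%:E /\ (ratr qr.2)%:E < Z1 w)}.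
  apply: filterS => w H; rewrite leNgt; apply/negP.
  move=> /ereal_rat_between[r [/ereal_rat_between[q [Zq qr] rZ]]].
  by apply: (H (q, r)) => //=; rewrite lte_fin ltr_rat in qr.
apply: ae_forall_count => -[q r] /=.
have [qr|] := boolP (q < r)%R; last by move=> _; exact: aeW.
(* For q <= 0 the event is empty since Z2 >= 0; for q > 0 all integrands below are nonnegative. *)
have [q0|q0] := leP (ratr q : R) 0%R.
  apply: aeW => w _ [+ _]; rewrite ltNge => /negP; apply.
  by apply: le_trans (Z20 w); rewrite lee_fin.
pose A := [set w | Z2 w < (ratr q)%:E] `&` [set w | (ratr r)%:E < Z1 w].
have GA : G A.
  rewrite -measurable_sigmaE; apply: measurableI.
    exact: (@measurable_lt _ GOm).
  exact: (@measurable_gt _ GOm).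
have mA : measurable A := Gm GA.
have qr' : (ratr q < ratr r :> R)%R by rewrite ltr_rat.
have mT f : measurable_fun setT f -> measurable_fun A f.
  by move=> mf; exact: measurable_funS mf.
have le : (ratr r)%:E * P A <= (ratr q)%:E * P A.
  rewrite -!integral_cst//.
  apply: (@le_trans _ _ (\int[P]_(w in A) Z1 w)).
    apply: ge0_le_integral => //.
    - by move=> w _; rewrite lee_fin ltW// (lt_trans q0).
    - by apply: mT; exact: measurable_fun_sub.
    - by move=> w [_ /ltW].
  rewrite YZ1//.
  apply: (@le_trans _ _ (\int[P]_(w in A) Y2 w)).
    apply: ae_ge0_le_integral => //; try exact: mT.
    by apply: filterS Y12 => w.
  rewrite -YZ2//; apply: ge0_le_integral => //.
  - by apply: mT; exact: measurable_fun_sub.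
  - by move=> w [/ltW].
have PA0 : P A = 0.
  have finA : P A \is a fin_num by exact: fin_num_measure.
  have P0 : 0 <= P A by exact: measure_ge0.
  move: le P0 finA; case: (P A) => [p| |] //=.
  rewrite !lee_fin => le p0 _; apply/eqP; rewrite eqe eq_le p0 andbT.
  by rewrite leNgt; apply/negP => p1; move: le; rewrite leNgt ltr_pM2r// qr'.
exists A; split => // w /=.
by move/not_implyP => [_ /contrapT].
Qed.

Lemma nncondexp_unique Y1 Y2 Z1 Z2 : nncondexp Y1 Z1 -> nncondexp Y2 Z2 ->
  {ae P, forall w, Y1 w = Y2 w} -> {ae P, forall w, Z1 w = Z2 w}.
Proof.
move=> c1 c2 Y12.
have Y21 : {ae P, forall w, Y2 w <= Y1 w} by apply: filterS Y12 => w ->.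
have {}Y12 : {ae P, forall w, Y1 w <= Y2 w} by apply: filterS Y12 => w ->.
have := nncondexp_le c1 c2 Y12; have := nncondexp_le c2 c1 Y21.
by apply: filterS2 => w H1 H2; apply/eqP; rewrite eq_le H1 H2.
Qed.

(** Conditional expectations of an increasing sequence increase only almost surely. The sequence is
    reset to 0 on a measurable null set outside which it is monotone, and ordinary monotone
    convergence applies. *)
Lemma ae_monotone_convergence (f : nat -> Om -> \bar R) (A : set Om) :
  measurable A -> (forall n, measurable_fun setT (f n)) ->
  (forall n w, 0 <= f n w) ->
  {ae P, forall w, forall m n, (m <= n)%N -> f m w <= f n w} ->
  \int[P]_(w in A) ereal_sup (range (f ^~ w)) =
    ereal_sup (range (fun n => \int[P]_(w in A) f n w)).
Proof.
move=> mA mf f0 [N [mN PN0 fN]].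
pose g n w := if w \in N then 0 else f n w.
have mg n : measurable_fun setT (g n).
  apply: measurable_fun_ifT => //.
  apply: (@measurable_fun_bool _ _ _ _ true).
  rewrite setTI (_ : _ @^-1` _ = N)//.
  by apply/seteqP; split => w /=; [move/set_mem|move/mem_set].
have gf n : \int[P]_(w in A) f n w = \int[P]_(w in A) g n w.
  apply: ae_eq_integral => //; try by apply: measurable_funS (mf n).
    by apply: measurable_funS (mg n).
  exists N; split => // w /= H; apply: contrapT => Nw; apply: H => _.
  by rewrite /g memNset.
have g_nd w : nondecreasing_seq (g ^~ w).
  move=> m n mn; rewrite /g; case: ifPn => // /negP wN.
  have : (forall m n, (m <= n)%N -> f m w <= f n w).
    by apply: contrapT => /fN /mem_set.
  exact.
have g0 n w : 0 <= g n w by rewrite /g; case: ifP.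
transitivity (\int[P]_(w in A) limn (g ^~ w)).
  have lg w : limn (g ^~ w) = ereal_sup (range (g ^~ w)).
    by apply/cvg_lim => //; exact: ereal_nondecreasing_cvgn.
  under [RHS]eq_integral do rewrite lg.
  apply: ae_eq_integral => //.
  - by apply: measurable_funS (measurable_sup mf).
  - by apply: measurable_funS (measurable_sup mg).
  exists N; split => // w /= H; apply: contrapT => Nw; apply: H => _.
  by congr ereal_sup; apply/seteqP; split => _ [n _ <-]; exists n => //;
    rewrite /g memNset.
rewrite monotone_convergence//; last by move=> n; apply: measurable_funS (mg n).
under [in RHS]eq_fun do rewrite gf.
apply/cvg_lim => //; apply: ereal_nondecreasing_cvgn => m n mn.
apply: ge0_le_integral => //; try by apply: measurable_funS (mg _).
by move=> w _; exact: g_nd.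
Qed.

(** Conditional monotone convergence; [nncondexp_le] supplies the almost sure monotonicity of
    [Z]. *)
Lemma nncondexp_sup (Y Z : nat -> Om -> \bar R) :
  (forall n, nncondexp (Y n) (Z n)) ->
  (forall w, nondecreasing_seq (Y ^~ w)) ->
  nncondexp (fun w => ereal_sup (range (Y ^~ w)))
            (fun w => ereal_sup (range (Z ^~ w))).
Proof.
move=> cYZ ndY; split.
- by apply: measurable_sup => n; case: (cYZ n).
- by apply: (@measurable_sup _ GOm) => n; case: (cYZ n).
- move=> w; apply: (@le_trans _ _ (Y 0%N w)); first by case: (cYZ 0%N).
  by apply: ereal_sup_ubound; exists 0%N.
- move=> w; apply: (@le_trans _ _ (Z 0%N w)); first by case: (cYZ 0%N).
  by apply: ereal_sup_ubound; exists 0%N.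
move=> A GA; rewrite !ae_monotone_convergence//; try exact: Gm.
- by congr ereal_sup; apply/seteqP; split => _ [n _ <-]; exists n => //;
    case: (cYZ n) => _ _ _ _ ->.
- by move=> n; case: (cYZ n).
- by move=> n w; case: (cYZ n).
- by apply: aeW => w m n; exact: ndY.
- by move=> n; case: (cYZ n) => _ /measurable_fun_sub.
- by move=> n w; case: (cYZ n).
have : {ae P, forall w, forall mn : nat * nat,
    (mn.1 <= mn.2)%N -> Z mn.1 w <= Z mn.2 w}.
  apply: ae_forall_count => -[m n] /=.
  have [mn|_] := boolP (m <= n)%N; last exact: aeW.
  have : {ae P, forall w, Y m w <= Y n w} by apply: aeW => w; exact: ndY.
  by move=> /(nncondexp_le (cYZ m) (cYZ n)); apply: filterS.
by apply: filterS => w H m n; exact: (H (m, n)).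
Qed.

(** The pieces where [t] is constant form a countable partition into events of [G], and on each of
    them the defining identity for one fixed index applies. Later [t] lists basic sets around a
    random point. *)
Lemma nncondexp_glue (I : countType) (t : Om -> I) (Y Z : I -> Om -> \bar R) :
  (forall i, nncondexp (Y i) (Z i)) -> (forall i, G (t @^-1` [set i])) ->
  nncondexp (fun w => Y (t w) w) (fun w => Z (t w) w).
Proof.
move=> cYZ Gt.
have glue (d' : measure_display) (T : measurableType d') (s : T -> I)
    (f : I -> T -> \bar R) : (forall i, measurable (s @^-1` [set i])) ->
    (forall i, measurable_fun setT (f i)) ->
    measurable_fun setT (fun w => f (s w) w).
  move=> ms mf; apply: emeasurable_gt => a.
  rewrite (_ : [set w | _] =
      \bigcup_i (s @^-1` [set i] `&` [set w | a%:E < f i w])).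
    apply: countable_bigcupT_measurable => // i.
    by apply: measurableI => //; exact: measurable_gt.
  by apply/seteqP; split => [w /= aw|w [i _ [/= <-]]//]; exists (s w).
have mY : measurable_fun setT (fun w => Y (t w) w).
  by apply: glue => i; [exact: Gm|case: (cYZ i)].
have mZ : measurable_fun setT ((fun w => Z (t w) w) : GOm -> \bar R).
  by apply: (glue _ GOm) => i; [rewrite measurable_sigmaE|case: (cYZ i)].
split => //; [by move=> w; case: (cYZ (t w))|by move=> w; case: (cYZ (t w))|].
move=> A GA.
(* The pieces are indexed by the code of [t w] so as to form a sequence; a code that is not attained
   gives an empty piece. *)
pose F (n : nat) := A `&` [set w | choice.pickle (t w) = n].
have GF n : G (F n).
  rewrite -measurable_sigmaE; apply: measurableI.
    by rewrite measurable_sigmaE.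
  rewrite (_ : [set w | _] =
      \bigcup_(i in [set i | choice.pickle i = n]) t @^-1` [set i]).
    apply: measurable_bigcup_count => i _.
    by rewrite measurable_sigmaE.
  by apply/seteqP; split => [w /= <-|w [i /= <- <-]]//; exists (t w).
have AF : A = \bigcup_n F n.
  apply/seteqP; split => [w Aw|w [n _ []]//].
  by exists (choice.pickle (t w)).
have tF : trivIset setT F.
  by move=> i j _ _ [w [[_ /= <-] [_ /= <-]]].
rewrite AF !ge0_integral_bigcup//.
- apply: eq_eseriesr => n _.
  have [[w0 [_ /= w0n]]|F0] := pselect (F n !=set0); last first.
    rewrite (_ : F n = set0) ?integral_set0//.
    by apply/seteqP; split => // w Fw; case: F0; exists w.
  have tn w : F n w -> t w = t w0.
    by move=> [_ /=]; rewrite -w0n; exact: (pcan_inj choice.pickleK).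
  transitivity (\int[P]_(w in F n) Z (t w0) w).
    by apply: eq_integral => w /set_mem/tn ->.
  case: (cYZ (t w0)) => _ _ _ _ ->//.
  by apply: eq_integral => w /set_mem/tn ->.
- by move=> k; exact: Gm.
- by apply: measurable_funS mY.
- by move=> w _; case: (cYZ (t w)).
- by move=> k; exact: Gm.
- by apply: measurable_funS (measurable_fun_sub mZ).
- by move=> w _; case: (cYZ (t w)).
Qed.

Lemma nncondexpD Y1 Y2 Z1 Z2 : nncondexp Y1 Z1 -> nncondexp Y2 Z2 ->
  nncondexp (fun w => Y1 w + Y2 w) (fun w => Z1 w + Z2 w).
Proof.
move=> [mY1 mZ1 Y10 Z10 YZ1] [mY2 mZ2 Y20 Z20 YZ2]; split.
- exact: emeasurable_funD.
- exact: (@emeasurable_funD _ GOm).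
- by move=> w; exact: adde_ge0.
- by move=> w; exact: adde_ge0.
move=> A GA; have mA := Gm GA.
have mZ1' := measurable_funTS (D := A) (measurable_fun_sub mZ1).
have mZ2' := measurable_funTS (D := A) (measurable_fun_sub mZ2).
by rewrite !ge0_integralD ?YZ1 ?YZ2//; exact: measurable_funTS.
Qed.

Lemma nncondexpZ (k : R) Y Z : (0 <= k)%R -> nncondexp Y Z ->
  nncondexp (fun w => k%:E * Y w) (fun w => k%:E * Z w).
Proof.
move=> k0 [mY mZ Y0 Z0 YZ]; split.
- exact: measurable_funeM.
- exact: (@measurable_funeM _ GOm).
- by move=> w; exact: mule_ge0.
- by move=> w; exact: mule_ge0.
move=> A GA; have mA := Gm GA.
have mZ' := measurable_funTS (D := A) (measurable_fun_sub mZ).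
by rewrite !ge0_integralZl ?YZ//; exact: measurable_funTS.
Qed.

End condexp.

(** * Conditional expectations of lower bounded variables *)

Section lower_bounded_condexp.
Context {R : realType} {d : measure_display} {Om : measurableType d}
  (P : probability Om R).
Variable G : set (set Om).
Hypothesis sG : sigma_algebra setT G.
Hypothesis Gm : G `<=` measurable.
Local Open Scope ereal_scope.
Local Notation GOm := (g_sigma_algebraType G).

(** Raising f to g = max(f, -k) changes it on a null set only and makes g + k nonnegative. The
    negative part of g is at most k, hence has a finite integral: integrating g + k + g^- = g^+ + k
    and subtracting gives additivity. The truncation at 0 is there because the lower bound holds
    only almost surely. *)
Lemma integralD_lower_bounded (f : Om -> \bar R) (k : Om -> R) (A : set Om) :
  measurable A -> measurable_fun setT f -> measurable_fun setT k ->
  (forall w, (0 <= k w)%R) -> \int[P]_(w in A) (k w)%:E < +oo ->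
  {ae P, forall w, - (k w)%:E <= f w} ->
  \int[P]_(w in A) maxe 0 (f w + (k w)%:E) =
  \int[P]_(w in A) f w + \int[P]_(w in A) (k w)%:E.
Proof.
move=> mA mf mk k0 kfin kf.
have mk' : measurable_fun setT (EFin \o k) by exact: measurableT_comp.
pose g w := maxe (f w) (- (k w)%:E).
have mg : measurable_fun setT g.
  by apply: measurable_maxe => //; exact: measurableT_comp.
have -> : \int[P]_(w in A) f w = \int[P]_(w in A) g w.
  apply: ae_eq_integral => //; try exact: measurable_funTS.
  by apply: filterS kf => w kw _; rewrite /g max_l.
have gk w : - (k w)%:E <= g w by rewrite /g le_max lexx orbT.
have gk0 w : 0 <= g w + (k w)%:E.
  by have := gk w; rewrite -leeBlDr// sub0e.
have -> : \int[P]_(w in A) maxe 0 (f w + (k w)%:E) =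
    \int[P]_(w in A) (g w + (k w)%:E).
  apply: eq_integral => w _; rewrite /g.
  have [fk|/ltW fk] := leP (f w) (- (k w)%:E).
    by rewrite [RHS]addeC subee// max_l// -leeBrDr// sub0e.
  by rewrite max_r// -leeBlDr// sub0e.
have neg_le w : g^\- w <= (k w)%:E.
  by rewrite funenegE ge_max lee_fin k0 andbT leeNl.
have neg_fin : \int[P]_(w in A) g^\- w \is a fin_num.
  rewrite ge0_fin_numE; last by apply: integral_ge0.
  apply: le_lt_trans kfin; apply: ge0_le_integral => //.
  - exact/measurable_funTS/measurable_funeneg.
  - exact: measurable_funTS.
have negfin w : g^\- w \is a fin_num.
  by rewrite ge0_fin_numE ?funeneg_ge0// (le_lt_trans (neg_le w)) ?ltry.
have E w : g w + (k w)%:E + g^\- w = g^\+ w + (k w)%:E.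
  by rewrite {1}[g]funeposneg addeAC subeK.
have mgk : measurable_fun setT (fun w => g w + (k w)%:E).
  exact: emeasurable_funD.
have IE : \int[P]_(w in A) (g w + (k w)%:E) + \int[P]_(w in A) g^\- w =
    \int[P]_(w in A) g^\+ w + \int[P]_(w in A) (k w)%:E.
  rewrite -!ge0_integralD//.
  - by apply: eq_integral => w _; exact: E.
  - exact/measurable_funTS/measurable_funepos.
  - by move=> w _; rewrite lee_fin.
  - exact: measurable_funTS.
  - exact: measurable_funTS.
  - exact/measurable_funTS/measurable_funeneg.
rewrite -[LHS](addeK _ neg_fin) IE addeAC; congr (_ + _).
by rewrite [RHS]integralE.
Qed.

(** Adding k to Y and its conditional expectation nu to Z leads back to the nonnegative case. On A =
    {Z < -nu} the integral of Y, hence of Z, is at least that of -k, which equals that of -nu; since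
    Z is strictly smaller than -nu there, A is null. *)
Lemma condexp_nncondexp (Y Z : Om -> \bar R) (k nu : Om -> R) :
  is_condexp P G Y Z -> measurable_fun setT Y ->
  nncondexp P G (EFin \o k) (EFin \o nu) -> \int[P]_w (k w)%:E < +oo ->
  {ae P, forall w, - (k w)%:E <= Y w} ->
  nncondexp P G (fun w => maxe 0 (Y w + (k w)%:E))
    (fun w => maxe 0 (Z w + (nu w)%:E)) /\
  {ae P, forall w, - (nu w)%:E <= Z w}.
Proof.
move=> [mZ YZ] mY [mk' mnu' k0' nu0' knu] kfin kY.
have k0 w : (0 <= k w)%R by have := k0' w; rewrite lee_fin.
have nu0 w : (0 <= nu w)%R by have := nu0' w; rewrite lee_fin.
have mk : measurable_fun setT k by exact/measurable_EFinP.
have mnu : measurable_fun setT (nu : GOm -> R) by exact/measurable_EFinP.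
have mZ' := measurable_fun_sub sG Gm mZ.
have mnu1 := measurable_fun_sub sG Gm mnu'.
have kfinA B : measurable B -> \int[P]_(w in B) (k w)%:E < +oo.
  move=> mB; apply: le_lt_trans kfin.
  have := @ge0_subset_integral _ _ _ P B setT mB measurableT (EFin \o k) mk'.
  by move=> /(_ (fun w _ => k0' w) (@subsetT _ _)).
pose A := [set w | Z w < - (nu w)%:E].
have GA : G A.
  rewrite -(measurable_sigmaE sG).
  rewrite (_ : A = [set w | Z w + (nu w)%:E < 0]).
    by apply: (@measurable_lt _ GOm); exact: (@emeasurable_funD _ GOm).
  by apply/seteqP; split => w; rewrite /A/= -lteBrDr// sub0e.
have mA := Gm GA.
have ZA w : A w -> Z w <= 0.
  by move=> /ltW/le_trans; apply; rewrite leeNl oppe0 lee_fin.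
have mNZ : measurable_fun setT (fun w => - Z w) by exact: measurableT_comp.
have YA : 0 <= \int[P]_(w in A) Y w + \int[P]_(w in A) (k w)%:E.
  rewrite -integralD_lower_bounded//; last exact: kfinA.
  by apply: integral_ge0 => w _; rewrite le_max lexx.
have nuA : \int[P]_(w in A) (nu w)%:E \is a fin_num.
  rewrite knu// ge0_fin_numE ?kfinA//.
  by apply: integral_ge0 => w _; rewrite lee_fin.
have NZ : \int[P]_(w in A) (- Z w) <= \int[P]_(w in A) (nu w)%:E.
  have ZN : \int[P]_(w in A) Z w = - \int[P]_(w in A) (- Z w).
    rewrite -integral_ge0N; first by apply: eq_integral => w _; rewrite oppeK.
    by move=> w Aw; rewrite leeNr oppe0 ZA.
  have := YA; rewrite -YZ// ZN.
  have -> : \int[P]_(w in A) (k w)%:E = \int[P]_(w in A) (nu w)%:E.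
    by rewrite knu.
  by rewrite addeC sube_ge0// nuA ?orbT.
have PA0 : P A = 0.
  pose W w := - Z w - (nu w)%:E.
  have W0 w : A w -> 0 < W w by move=> Aw; rewrite /W lteBrDr// add0e lteNr.
  have mW : measurable_fun setT W by apply: emeasurable_funB.
  have IW : \int[P]_(w in A) `|W w| = 0.
    apply/eqP; rewrite eq_le; apply/andP; split; last exact: integral_ge0.
    rewrite (eq_integral W); last first.
      by move=> w /set_mem/W0/ltW/gee0_abs.
    rewrite -(leeD2rE _ _ nuA) add0e; apply: le_trans NZ.
    rewrite -ge0_integralD//.
    - rewrite le_eqVlt; apply/orP; left; apply/eqP; apply: eq_integral => w _.
      by rewrite /W subeK.
    - by move=> w /W0/ltW.
    - exact: measurable_funTS.
    - by move=> w _; rewrite lee_fin.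
    - exact: measurable_funTS.
  apply: measure_negligible => //.
  have := (ae_eq_integral_abs P mA (measurable_funTS mW)).1 IW.
  move=> [N [mN PN NP]]; exists N; split => // w Aw; apply: NP => /(_ Aw)/= W0'.
  by have := W0 w Aw; rewrite W0' ltxx.
have nuZ : {ae P, forall w, - (nu w)%:E <= Z w}.
  by exists A; split => // w /= /negP; rewrite -ltNge.
split => //; split.
- apply: measurable_maxe => //; exact: emeasurable_funD.
- apply: (@measurable_maxe _ GOm) => //; exact: (@emeasurable_funD _ GOm).
- by move=> w; rewrite le_max lexx.
- by move=> w; rewrite le_max lexx.
move=> B GB; have mB := Gm GB.
rewrite !integralD_lower_bounded//.
- by rewrite YZ// knu.
- exact: kfinA.
- exact/measurable_EFinP.
- by rewrite knu//; exact: kfinA.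
Qed.

End lower_bounded_condexp.

Import HBSimple HBNNSimple.

Notation borel E := (g_sigma_algebraType (@open E)).

(** * Measurable functions and versions that factor through a random variable *)

Section factorization.
Context {R : realType} {d : measure_display} {Om : measurableType d}.
Local Open Scope ereal_scope.

Lemma sigma_algebra_sigma_of (E : topologicalType) (X : Om -> E) :
  sigma_algebra setT (sigma_of X).
Proof.
apply: sigma_algebra_preimage; exact: smallest_sigma_algebra.
Qed.

(* Doob-Dynkin *)
Lemma sigma_of_factor (E : ptopologicalType) (X : Om -> E) (Z : Om -> \bar R) :
  measurable_fun setT (Z : g_sigma_algebraType (sigma_of X) -> \bar R) ->
  exists zeta : E -> \bar R,
    measurable_fun setT (zeta : borel E -> \bar R) /\
    forall w, Z w = zeta (X w).
Proof.
move=> mZ.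
have sG := sigma_algebra_sigma_of X.
have H (q : rat) : exists B : set E, borel_sets B /\
    forall w, Z w < (ratr q)%:E <-> B (X w).
  have : sigma_of X [set w | Z w < (ratr q)%:E].
    rewrite -(measurable_sigmaE sG).
    exact: (@measurable_lt _ (g_sigma_algebraType (sigma_of X))).
  move=> [B mB ZB]; exists B; split => // w.
  change ([set w | Z w < (ratr q)%:E] w <-> B (X w)).
  by rewrite -ZB; split => [[]|].
have [B BP] := choice H.
(* [Z] is rebuilt from its sublevel events {Z < q} = {X in B q}. The sets [B q] need not be nested
   off the range of [X], but the infimum defines a measurable function on all of [E]. *)
exists (fun e => ereal_inf [set (ratr q)%:E | q in [set q | B q e]]); split.
  apply: (@emeasurable_lt _ (borel E)) => a.
  rewrite (_ : [set w | _] = \bigcup_(q in [set q : rat | (ratr q < a)%R]) B q).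
    by apply: measurable_bigcup_count => q _; case: (BP q).
  apply/seteqP; split => e /=.
    by move=> /ereal_inf_lt[_ [q Bq <-]]; rewrite lte_fin => qa; exists q.
  move=> [q /= qa Bq].
  apply: (@le_lt_trans _ _ (ratr q)%:E); last by rewrite lte_fin.
  by apply: ereal_inf_lbound; exists q.
move=> w; apply/eqP; rewrite eq_le; apply/andP; split.
  by apply: le_ereal_inf_tmp => _ [q /= /((BP q).2 w)/ltW Zq <-].
rewrite leNgt; apply/negP => /ereal_rat_between[q [Zq qi]].
move: qi; rewrite ltNge => /negP; apply; apply: ereal_inf_lbound.
by exists q => //; apply/((BP q).2 w).
Qed.

End factorization.

Section conditional_factorization.
Context {R : realType} {d : measure_display} {Om : measurableType d}
  (P : probability Om R).
Variable F : set (set Om).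
Hypothesis sF : sigma_algebra setT F.
Hypothesis Fm : F `<=` measurable.
Local Open Scope ereal_scope.
Variables (E E' : ptopologicalType) (xi : Om -> E) (theta : Om -> E').
Hypothesis mtheta : rv_measurable F theta.

(** The conditional law of [xi] given [F] depends on [theta] only, expressed by one version per
    Borel set instead of a kernel. Simple functions and monotone limits extend it to nonnegative
    functions. *)
Definition condexp_factors : Prop :=
  forall B : set E, borel_sets B -> exists zeta : E' -> \bar R,
    measurable_fun setT (zeta : borel E' -> \bar R) /\
    nncondexp P F (fun w => (\1_B (xi w))%:E) (fun w => zeta (theta w)).

Hypothesis cf : condexp_factors.

Lemma condexp_factors_simple (B : R -> set E) (s : seq R) :
  (forall r, borel_sets (B r)) -> (forall r, r \in s -> (0 <= r)%R) ->
  exists zeta : E' -> \bar R,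
    measurable_fun setT (zeta : borel E' -> \bar R) /\
    nncondexp P F (fun w => \sum_(r <- s) (r%:E * (\1_(B r) (xi w))%:E))
      (fun w => zeta (theta w)).
Proof.
move=> mB; elim: s => [_|r s IH rs].
  exists (cst 0); split => //.
  under eq_fun do rewrite big_nil.
  by split => //; exact: measurable_cst.
have [|zeta [mzeta Hzeta]] := IH.
  by move=> x xs; apply: rs; rewrite inE xs orbT.
have [z [mz Hz]] := cf (mB r).
exists (fun e => r%:E * z e + zeta e); split.
  apply: (@emeasurable_funD _ (borel E')) => //.
  exact: (@measurable_funeM _ (borel E')).
under eq_fun do rewrite big_cons.
apply: nncondexpD => //; apply: nncondexpZ => //.
by apply: rs; rewrite inE eqxx.
Qed.

Lemma condexp_factors_fun (y : E -> \bar R) :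
  measurable_fun setT (y : borel E -> \bar R) -> (forall e, 0 <= y e) ->
  exists zeta : E' -> \bar R,
    measurable_fun setT (zeta : borel E' -> \bar R) /\
    nncondexp P F (fun w => y (xi w)) (fun w => zeta (theta w)).
Proof.
move=> my y0.
pose f := @nnsfun_approx _ (borel E) R setT measurableT y my.
have H n : exists zeta : E' -> \bar R,
    measurable_fun setT (zeta : borel E' -> \bar R) /\
    nncondexp P F (fun w => (f n (xi w))%:E) (fun w => zeta (theta w)).
  have [||zeta [mz Hz]] := @condexp_factors_simple
      (fun r => f n @^-1` [set r]) (fset_set (range (f n))).
  - by move=> r; exact: (@measurable_sfunP _ _ (borel E)).
  - move=> r; rewrite in_fset_set// inE => -[e _ <-]; exact: fun_ge0.
  exists zeta; split => //.
  move: Hz; congr (nncondexp P F _ _); apply/funext => w.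
  by rewrite (fimfunE (f n)) fsbig_finite//= -sumEFin.
have [zeta zetaP] := choice H.
exists (fun e => ereal_sup (range (zeta ^~ e))); split.
  by apply: (@measurable_sup _ (borel E')) => n; case: (zetaP n).
have := nncondexp_sup sF Fm (fun n => (zetaP n).2).
have nd w : nondecreasing_seq (fun n => (f n (xi w))%:E).
  move=> m n mn; rewrite lee_fin.
  by have /lefP/(_ (xi w)) := nd_nnsfun_approx measurableT my mn.
move=> /(_ nd); congr (nncondexp P F _ _); apply/funext => w.
have := cvg_nnsfun_approx measurableT my (fun e _ => y0 e) (Logic.I : setT (xi w)).
move=> /cvg_lim <-//.
apply/esym/cvg_lim => //; exact: (ereal_nondecreasing_cvgn (nd w)).
Qed.

End conditional_factorization.

(** * Conditional expectations of integrands *)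

Section conditional_integrand.
Context {R : realType} {V : normedModType R}.
Variable C : nat -> set V.
Hypothesis bC : compact_base C.
Local Open Scope ereal_scope.

(** Finite lists form a countable type, and the empty list gives the whole space, so that the
    infimum over [cell [::]] is the global one. *)
Definition cell (s : seq nat) : set V :=
  [set x | forall k, k \in s -> (C k)^° x].

Lemma open_cell s : open (cell s).
Proof.
elim: s => [|k s IH].
  rewrite (_ : cell [::] = setT); first exact: openT.
  by apply/seteqP; split.
rewrite (_ : cell (k :: s) = (C k)^° `&` cell s).
  by apply: openI => //; exact: open_interior.
apply/seteqP; split => x.
  move=> H; split; first by apply: H; rewrite inE eqxx.
  by move=> j js; apply: H; rewrite inE js orbT.
by move=> [H1 H2] j; rewrite inE => /predU1P[->|/H2].
Qed.

Lemma cell_subset (s s' : seq nat) : {subset s <= s'} -> cell s' `<=` cell s.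
Proof. by move=> ss' x sx k /ss'; exact: sx. Qed.

(* [cell (cells_at x n)] decreases with [n] to a base at [x], and [cells_at x n]
   takes countably many values, so that one can condition on it. *)
Fixpoint cells_at (x : V) (n : nat) : seq nat :=
  if n is m.+1 then
    if `[< (C m)^° x >] then m :: cells_at x m else cells_at x m
  else [::].

Lemma mem_cells_at x n k : (k \in cells_at x n) = (k < n)%N && `[< (C k)^° x >].
Proof.
elim: n => [|n IH] //=.
case: ifPn => xn; rewrite ?inE IH ltnS (leq_eqVlt k n).
  by case: eqVneq => //= ->.
by case: eqVneq => //= ->; rewrite ltnn (negbTE xn).
Qed.

Lemma cells_at_cell x n : cell (cells_at x n) x.
Proof. by move=> k; rewrite mem_cells_at => /andP[_ /asboolP]. Qed.

Lemma cells_at_subset x m n : (m <= n)%N ->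
  {subset cells_at x m <= cells_at x n}.
Proof.
move=> mn k; rewrite !mem_cells_at => /andP[km ->].
by rewrite (leq_trans km).
Qed.

Lemma subset_cells_at x s : cell s x -> exists n, {subset s <= cells_at x n}.
Proof.
move=> sx; exists (\max_(k <- s) k).+1 => k ks.
rewrite mem_cells_at ltnS (@leq_bigmax_seq _ s xpredT id k ks isT)/=.
by apply/asboolP; exact: sx.
Qed.

Lemma measurable_cells_at {d} {T : measurableType d} (X : T -> V) n s :
  measurable_fun setT (X : T -> borel V) ->
  measurable [set w | cells_at (X w) n = s].
Proof.
move=> mX; elim: n s => [|n IH] s.
  case: s => [|a s].
    by rewrite (_ : [set w | _] = setT)//; apply/seteqP; split.
  by rewrite (_ : [set w | _] = set0)//; apply/seteqP; split.
have mXn : measurable (X @^-1` (C n)^°).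
  rewrite -[X in measurable X]setTI; apply: mX => //.
  by apply: sub_sigma_algebra; exact: open_interior.
rewrite (_ : [set w | _] =
    X @^-1` (C n)^° `&` [set w | n :: cells_at (X w) n = s] `|`
    ~` (X @^-1` (C n)^°) `&` [set w | cells_at (X w) n = s]).
  apply: measurableU; apply: measurableI => //; last exact: measurableC.
  case: s => [|a s].
    by rewrite (_ : [set w | _] = set0)//; apply/seteqP; split.
  have [->|na] := eqVneq a n.
    rewrite (_ : [set w | _] = [set w | cells_at (X w) n = s]); first exact: IH.
    by apply/seteqP; split => w /= => [[->]|->].
  rewrite (_ : [set w | _] = set0)//; apply/seteqP; split => // w /= [na'].
  by rewrite na' eqxx in na.
apply/seteqP; split => w /=; case: asboolP => H.
- by left.
- by right.
- by move=> [[]|[]].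
- by move=> [[]|[]].
Qed.

(** This replaces the supremum over all basic neighbourhoods by the limit of an increasing sequence,
    the form that monotone convergence handles. *)
Lemma sup_cells_at (f : V -> \bar R) (x : V) : closed (epi f) ->
  f x = ereal_sup (range (fun n => ereal_inf [set f y | y in cell (cells_at x n)])).
Proof.
move=> cf; apply/eqP; rewrite eq_le; apply/andP; split; last first.
  apply: ge_ereal_sup => _ [n _ <-]; apply: ereal_inf_lbound.
  by exists x => //; exact: cells_at_cell.
rewrite {1}(lsc_sup_inf x (interior_base bC) cf).
apply: ge_ereal_sup => _ [k /= kx <-].
have [n kn] : exists n, {subset [:: k] <= cells_at x n}.
  by apply: subset_cells_at => j; rewrite inE => /eqP ->.
apply: (@le_trans _ _ (ereal_inf [set f y | y in cell (cells_at x n)])).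
  apply: ereal_inf_subset => y /(cell_subset kn); apply.
  by rewrite inE.
by apply: ereal_sup_ubound; exists n.
Qed.

Lemma measurable_normal_comp {d} {T : measurableType d} (h : V -> T -> \bar R)
    (X : T -> V) : normal_integrand measurable h ->
  measurable_fun setT (X : T -> borel V) ->
  measurable_fun setT (fun w => h (X w) w).
Proof.
move=> hN mX; apply: emeasurable_gt => a.
rewrite (_ : [set w | _] = \bigcup_k (X @^-1` (C k)^° `&`
    [set w | a%:E < ereal_inf [set h y w | y in (C k)^°]])).
  apply: bigcup_measurable => k _; apply: measurableI.
    rewrite -[X in measurable X]setTI; apply: mX => //.
    by apply: sub_sigma_algebra; exact: open_interior.
  by apply: measurable_gt; apply: measurable_inf_open => //; exact: open_interior.
apply/seteqP; split => w /=.
  rewrite {1}(normal_sup_inf bC _ (hN.1 w)) => /ereal_sup_gt[_ [k /= kx <-] ak].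
  by exists k.
move=> [k _ [/= kX ak]]; apply: (lt_le_trans ak).
by apply: ereal_inf_lbound; exists (X w).
Qed.

Context {d : measure_display} {Om : measurableType d} (P : probability Om R).
Variable F : set (set Om).
Hypothesis sF : sigma_algebra setT F.
Hypothesis Fm : F `<=` measurable.
Variables (E E' : ptopologicalType) (xi : Om -> E) (theta : Om -> E').
Hypothesis mxi : measurable_fun setT (xi : Om -> borel E).
Hypothesis mtheta : rv_measurable F theta.
Hypothesis cf : condexp_factors P F xi theta.
Variables h g : V -> Om -> \bar R.
Hypothesis hN : normal_integrand measurable h.
Hypothesis hlb : lower_bounded P h.
Hypothesis hxi : depends_only_through P h xi.
Hypothesis gh : is_cond_integrand P F h g.

Local Notation FOm := (g_sigma_algebraType F).

(** The infima over cells are almost surely bounded below by an integrable function of [xi]. Shifted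
    by it and truncated at 0, they have conditional expectations that are functions of [theta];
    undoing the shift and taking suprema over cells yields an integrand that uniqueness identifies
    with [g]. *)
Lemma cond_integrand_depends : depends_only_through P g theta.
Proof.
have FE := measurable_sigmaE sF.
have FT : F setT by rewrite -FE; exact: measurableT.
have [H [HN hH]] := hxi.
pose q s e := ereal_inf [set H x e | x in cell s].
have mq s : measurable_fun setT (q s : borel E -> \bar R).
  apply: (@measurable_inf_open _ _ _ (borel E)) => //; exact: open_cell.
have q_le s s' e : {subset s <= s'} -> q s e <= q s' e.
  by move=> ss'; apply: ereal_inf_subset; exact: cell_subset.
(* The shift by [k] makes the integrand nonnegative; [fine +oo = 0] makes [k]
   finite also where the infimum is -oo, which is a null event. *)
pose k e : R := fine (maxe 0 (- q [::] e)).
have k0 e : (0 <= k e)%R by apply: fine_ge0; rewrite le_max lexx.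
have mk : measurable_fun setT (k : borel E -> R).
  apply: measurableT_comp => //; apply: measurable_maxe => //.
  exact: measurableT_comp.
have [m [im hm]] := hlb.
have qm : {ae P, forall w, (m w)%:E <= q [::] (xi w)}.
  apply: filterS2 hH hm => w hHw mw; apply: le_ereal_inf_tmp => _ [x _ <-].
  by rewrite -hHw.
have kq : {ae P, forall w, - (k (xi w))%:E <= q [::] (xi w)}.
  apply: filterS qm => w; rewrite /k; case: (q _ _) => [r| |]//= mr.
  - rewrite -EFin_max/= lee_fin lerNl.
    by rewrite le_max lexx orbT.
  - by rewrite leey.
have kfin : \int[P]_w (k (xi w))%:E < +oo.
  have /integrableP[mm mfin] := im.
  apply: le_lt_trans mfin; apply: ae_ge0_le_integral => //.
  - by move=> w _; rewrite lee_fin.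
  - by apply/measurable_EFinP; exact: measurableT_comp mk mxi.
  - exact: measurableT_comp.
  apply: filterS qm => w mq' _ /=; rewrite lee_fin /k.
  move: mq'; case: (q _ _) => [r| |]//= mr.
  - rewrite -EFin_max/= ge_max normr_ge0/=.
    rewrite lee_fin in mr.
    apply: (@le_trans _ _ (- m w)%R); first by rewrite lerN2.
    by rewrite -normrN ler_norm.
(* [kap] is infinite at most on a null event, because the shift is integrable. Its finite part is
   therefore still a version, and it can be subtracted everywhere. *)
have [nu [mnu Hnu]] : exists nu : E' -> R,
    measurable_fun setT (nu : borel E' -> R) /\
    nncondexp P F (fun w => (k (xi w))%:E) (fun w => (nu (theta w))%:E).
  have mk' : measurable_fun setT (EFin \o k : borel E -> \bar R).
    exact: measurableT_comp.
  have [kap [mkap Hkap]] := condexp_factors_fun sF Fm cf mk' (fun e => k0 e).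
  have [mYk mZk Yk0 Zk0 YZk] := Hkap.
  have mnu : measurable_fun setT (fine \o kap : borel E' -> R).
    exact: measurableT_comp.
  have mEnu : measurable_fun setT (EFin \o (fine \o kap) : borel E' -> \bar R).
    exact: measurableT_comp.
  exists (fine \o kap); split => //; split.
  - exact: mYk.
  - exact: (measurableT_comp mEnu mtheta).
  - exact: Yk0.
  - by move=> w; rewrite lee_fin; exact: fine_ge0.
  have mkap' := measurable_fun_sub sF Fm mZk.
  move=> A FA; rewrite -YZk//; apply: ae_eq_integral.
  - exact: Fm.
  - apply: measurable_funTS; apply: (measurable_fun_sub sF Fm).
    exact: (measurableT_comp mEnu mtheta).
  - exact: measurable_funTS.
  have ik : P.-integrable setT (fun w => kap (theta w)).
    apply/integrableP; split => //.
    under eq_integral do rewrite gee0_abs//.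
    by rewrite YZk.
  have := integrable_ae measurableT ik.
  by apply: filterS => w kfn _; rewrite /= fineK// kfn.
pose y s e := maxe 0 (q s e + (k e)%:E).
have my s : measurable_fun setT (y s : borel E -> \bar R).
  apply: measurable_maxe => //; apply: emeasurable_funD => //.
  exact: measurableT_comp.
have y0 s e : 0 <= y s e by rewrite le_max lexx.
have y_le s s' e : {subset s <= s'} -> y s e <= y s' e.
  by move=> ss'; rewrite /y ge_max !le_max lexx/= leeD2r ?orbT// q_le.
have [kappa kappaP] := choice (fun s => condexp_factors_fun sF Fm cf (my s) (y0 s)).
(* A longer list shrinks the cell and raises the infimum. There are countably many pairs of lists,
   so one null set serves them all. *)
have kappa_le : {ae P, forall w, forall ss' : seq nat * seq nat,
    {subset ss'.1 <= ss'.2} -> kappa ss'.1 (theta w) <= kappa ss'.2 (theta w)}.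
  apply: ae_forall_count => -[s s'] /=.
  have [ss'|nss'] := pselect {subset s <= s'}; last exact: aeW.
  have : {ae P, forall w, y s (xi w) <= y s' (xi w)}.
    by apply: aeW => w; exact: y_le.
  move/(nncondexp_le sF Fm (kappaP s).2 (kappaP s').2).
  by apply: filterS.
pose b s e := kappa s e - (nu e)%:E.
pose gamma x e := ereal_sup [set b s e | s in [set s | cell s x]].
have mb s : measurable_fun setT (b s : borel E' -> \bar R).
  apply: emeasurable_funB; first by case: (kappaP s).
  exact: measurableT_comp.
have gammaN : normal_integrand (@borel_sets E') gamma.
  exact: (@normal_sup _ _ _ (borel E') C bC _ cell b open_cell mb).
exists gamma; split => //.
(* It remains to compare [g] and [gamma] along [F]-measurable random points. *)
apply: (normal_integrand_ae_eq bC sF gh.1).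
  rewrite -FE; apply: (@normal_sup _ _ _ FOm C bC _ cell
    (fun s w => b s (theta w)) open_cell) => s.
  exact: (measurableT_comp (mb s) mtheta).
move=> X mX.
pose s n w := cells_at (X w) n.
have mX' : measurable_fun setT (X : Om -> borel V) := measurable_fun_sub sF Fm mX.
have Fs n t : F (s n @^-1` [set t]).
  rewrite -FE; exact: (@measurable_cells_at _ FOm X n t mX).
have s_nd w m' n' : (m' <= n')%N -> {subset s m' w <= s n' w}.
  exact: cells_at_subset.
(* On each event of [F] where the list [s n] is constant, the version is the corresponding [kappa];
   gluing covers the random cell around [X]. *)
have cond_n n := nncondexp_glue sF Fm (fun t => (kappaP t).2) (Fs n).
have := nncondexp_sup sF Fm cond_n.
have y_nd w : nondecreasing_seq (fun n => y (s n w) (xi w)).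
  by move=> m' n' mn; apply: y_le; exact: s_nd.
move=> /(_ y_nd) cond_sup.
have mhX : measurable_fun setT (fun w => h (X w) w).
  exact: measurable_normal_comp.
have khX : {ae P, forall w, - (k (xi w))%:E <= h (X w) w}.
  apply: filterS2 kq hH => w kw hHw; apply: (le_trans kw).
  by rewrite hHw; apply: ereal_inf_lbound; exists (X w).
have [cond_h nug] := condexp_nncondexp sF Fm (gh.2 X mX) mhX Hnu kfin khX.
have hX : {ae P, forall w, maxe 0 (h (X w) w + (k (xi w))%:E) =
    ereal_sup (range (fun n => y (s n w) (xi w)))}.
  apply: filterS hH => w hHw.
  have hE : h (X w) w = ereal_sup (range (fun n => q (s n w) (xi w))).
    by rewrite hHw (sup_cells_at (X w) (HN.1 (xi w))).
  apply/eqP; rewrite eq_le; apply/andP; split; last first.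
    apply: ge_ereal_sup => _ [n _ <-]; rewrite /y ge_max !le_max lexx/=.
    apply/orP; right; rewrite leeD2r// hE.
    by apply: ereal_sup_ubound; exists n.
  rewrite ge_max; apply/andP; split.
    by apply: le_trans (y0 (s 0%N w) (xi w)) _; apply: ereal_sup_ubound; exists 0%N.
  rewrite -leeBrDr// hE; apply: ge_ereal_sup => _ [n _ <-].
  rewrite leeBrDr//; apply: (@le_trans _ _ (y (s n w) (xi w))).
    by rewrite /y le_max lexx orbT.
  by apply: ereal_sup_ubound; exists n.
(* The conditional expectation of the shifted h(X) is computed twice: from [g], and as the limit
   along the shrinking cells around [X]. *)
have := nncondexp_unique sF Fm cond_h cond_sup hX.
move=> gE; apply: filterS3 gE nug kappa_le => w gw nuw kw.
have {}gw : g (X w) w + (nu (theta w))%:E =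
    ereal_sup (range (fun n => kappa (s n w) (theta w))).
  rewrite -gw max_r//.
  by rewrite -leeBlDr// sub0e.
have -> : g (X w) w = g (X w) w + (nu (theta w))%:E - (nu (theta w))%:E.
  by rewrite addeK.
rewrite gw.
(* [gamma] takes the supremum over all cells containing [X w], not just those of the sequence. Every
   list of basic sets around [X w] is included in some [s n w], so by [kappa_le] the two suprema
   agree. *)
apply/eqP; rewrite eq_le; apply/andP; split.
  rewrite leeBlDr//; apply: ge_ereal_sup => _ [n _ <-].
  rewrite -leeBlDr//; apply: ereal_sup_ubound; exists (s n w) => //=.
  exact: cells_at_cell.
apply: ge_ereal_sup => _ [t /= tX <-]; rewrite /b leeD2r//.
have [n tn] := subset_cells_at tX.
apply: (@le_trans _ _ (kappa (s n w) (theta w))); first exact: (kw (t, s n w)).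
by apply: ereal_sup_ubound; exists n.
Qed.

End conditional_integrand.

(** * Dependence through a random variable *)

Section dependence.
Context {R : realType} {d : measure_display} {Om : measurableType d}
  (P : probability Om R).
Local Open Scope ereal_scope.

Lemma continuous_borel (E1 E2 : ptopologicalType) (f : E1 -> E2) :
  continuous f -> measurable_fun setT (f : borel E1 -> borel E2).
Proof.
move=> cf.
apply: (@measurability _ _ (borel E1) (borel E2) _ _ (@open E2)) => //.
move=> _ [U oU <-]; rewrite setTI; apply: sub_sigma_algebra.
exact: open_comp.
Qed.

(** Boxes of interiors form a countable base of the product, so the preimage of an open set is a
    countable union of measurable intersections. *)
Lemma measurable_borel_pair (E1 E2 : ptopologicalType) (C1 : nat -> set E1)
    (C2 : nat -> set E2) d' (T : measurableType d') (f : T -> E1) (g : T -> E2) :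
  compact_base C1 -> compact_base C2 ->
  measurable_fun setT (f : T -> borel E1) ->
  measurable_fun setT (g : T -> borel E2) ->
  measurable_fun setT ((fun w => (f w, g w)) : T -> borel (E1 * E2)%type).
Proof.
move=> b1 b2 mf mg.
apply: (@measurability _ _ _ (borel (E1 * E2)%type) _ _ (@open (E1 * E2)%type)) => //.
move=> _ [U oU <-]; rewrite setTI.
pose O (n : nat * nat) := (C1 n.1)^° `*` (C2 n.2)^°.
rewrite (_ : _ @^-1` U = \bigcup_(n in [set n | O n `<=` U])
    (f @^-1` (C1 n.1)^° `&` g @^-1` (C2 n.2)^°)).
  apply: measurable_bigcup_count => n _; apply: measurableI.
    rewrite -[X in measurable X]setTI; apply: mf => //.
    by apply: sub_sigma_algebra; exact: open_interior.
  rewrite -[X in measurable X]setTI; apply: mg => //.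
  by apply: sub_sigma_algebra; exact: open_interior.
apply/seteqP; split => w /=; last by move=> [n /= nU [? ?]]; exact: nU.
move=> Uw; have [[A B] /= [fA gB] AB] := open_nbhs_nbhs (conj oU Uw).
have [i [fi iA]] := interior_base b1 fA.
have [j [gj jB]] := interior_base b2 gB.
exists (i, j) => //= -[x y] [/= /iA ? /jB ?]; exact: AB.
Qed.

Lemma depends_only_through_comp {V : normedModType R} (E1 E2 : ptopologicalType)
    (h : V -> Om -> \bar R) (f : E1 -> E2) (xi : Om -> E1) : continuous f ->
  depends_only_through P h (f \o xi) -> depends_only_through P h xi.
Proof.
move=> cf [H [[cH HN] hH]]; exists (fun x e => H x (f e)); split => //; split.
  by move=> e; exact: cH.
move=> O /HN mO; have := continuous_borel cf measurableT mO.
by rewrite setTI.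
Qed.

(** A partial infimum of [H] may fail to be lower semicontinuous, so the witness is regenerated from
    the infima of [H] over slabs. It agrees almost surely with [j] because the epigraph of [j] is
    closed. *)
Lemma depends_only_through_inf {U W : normedModType R} (C : nat -> set U)
    (E : ptopologicalType) (xi : Om -> E) (h : U * W -> Om -> \bar R)
    (j : U -> Om -> \bar R) : compact_base C ->
  depends_only_through P h xi -> (forall w, closed (epi (j ^~ w))) ->
  {ae P, forall w, forall x, j x w = ereal_inf [set h (x, u) w | u in setT]} ->
  depends_only_through P j xi.
Proof.
move=> bC [H [HN hH]] cj jh.
pose b k e := ereal_inf [set H p e | p in (C k)^° `*` setT].
exists (fun x e => ereal_sup [set b k e | k in [set k | (C k)^° x]]); split.
  apply: (@normal_sup _ _ _ (borel E) C bC _ (fun k => (C k)^°) b) => k.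
    exact: open_interior.
  apply: (@measurable_inf_open _ _ _ (borel E)) => //.
  by apply: open_setX; [exact: open_interior|exact: openT].
apply: filterS2 hH jh => w hHw jhw x.
rewrite (lsc_sup_inf x (interior_base bC) (cj w)).
congr ereal_sup; apply/eq_imagel => k _.
apply/eqP; rewrite eq_le; apply/andP; split.
  apply: le_ereal_inf_tmp => _ [[z u] [/= Cz _] <-].
  rewrite -hHw; apply: (@le_trans _ _ (j z w)).
    by apply: ereal_inf_lbound; exists z.
  by rewrite jhw; apply: ereal_inf_lbound; exists u.
apply: le_ereal_inf_tmp => _ [z Cz <-]; rewrite jhw.
apply: le_ereal_inf_tmp => _ [u _ <-]; rewrite hHw.
by apply: ereal_inf_lbound; exists (z, u).
Qed.

(** A real [c] can be moved to the right-hand side. If [c] is +oo, one term above -oo already forces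
    [s] to be +oo, whence the nonemptiness and the bounds on [a]. *)
Lemma ereal_supD_le (I : Type) (A : set I) (a : I -> \bar R) (c s : \bar R) :
  A !=set0 -> (forall i, A i -> -oo < a i) -> -oo < c ->
  (forall i, A i -> a i + c <= s) -> ereal_sup [set a i | i in A] + c <= s.
Proof.
move=> [i0 Ai0] aNy cNy acs; case: c cNy acs => [r| |]// _ acs.
  rewrite -leeBrDr//; apply: ge_ereal_sup => _ [i Ai <-].
  by rewrite leeBrDr// acs.
have := acs i0 Ai0; rewrite addey ?gt_eqF ?aNy// leye_eq => /eqP ->.
exact: leey.
Qed.

(** Sums of infima over two basic neighbourhoods generate the sum of the integrands, since suprema
    add when no term is -oo; the lower bounds ensure this almost surely. *)
Lemma depends_only_through_add {U W : normedModType R} (C : nat -> set (U * W))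
    (D : nat -> set W) (E : ptopologicalType) (xi : Om -> E)
    (h : U * W -> Om -> \bar R) (j : W -> Om -> \bar R) :
  compact_base C -> compact_base D ->
  depends_only_through P h xi -> depends_only_through P j xi ->
  lower_bounded P h -> lower_bounded P j ->
  depends_only_through P (fun p w => h p w + j p.2 w) xi.
Proof.
move=> bC bD [H [HN hH]] [J [JN jJ]] [m [_ hm]] [n [_ jn]].
pose O (i : nat * nat) := (C i.1)^° `&` snd @^-1` (D i.2)^°.
pose a k e := ereal_inf [set H p e | p in (C k)^°].
pose b k e := ereal_inf [set J p e | p in (D k)^°].
exists (fun p e => ereal_sup [set a i.1 e + b i.2 e | i in [set i | O i p]]).
split.
  apply: (@normal_sup _ _ _ (borel E) C bC _ O (fun i e => a i.1 e + b i.2 e)) => i.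
    apply: openI; first exact: open_interior.
    apply: open_comp; last exact: open_interior.
    by move=> p _; exact: cvg_snd.
  apply: emeasurable_funD; apply: (@measurable_inf_open _ _ _ (borel E)) => //;
    exact: open_interior.
apply: filterS2 (filterI hH jJ) (filterI hm jn) => w [hHw jJw] [hmw jnw] p.
have aNy k : -oo < a k (xi w).
  apply: (@lt_le_trans _ _ (m w)%:E); first exact: ltNyr.
  by apply: le_ereal_inf_tmp => _ [z _ <-]; rewrite -hHw.
have bNy k : -oo < b k (xi w).
  apply: (@lt_le_trans _ _ (n w)%:E); first exact: ltNyr.
  by apply: le_ereal_inf_tmp => _ [z _ <-]; rewrite -jJw.
have hE : h p w = ereal_sup [set a k (xi w) | k in [set k | (C k)^° p]].
  rewrite hHw.
  exact: (lsc_sup_inf (f := H ^~ (xi w)) p (interior_base bC) (HN.1 _)).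
have jE : j p.2 w = ereal_sup [set b k (xi w) | k in [set k | (D k)^° p.2]].
  rewrite jJw.
  exact: (lsc_sup_inf (f := J ^~ (xi w)) p.2 (interior_base bD) (JN.1 _)).
apply/eqP; rewrite eq_le; apply/andP; split; last first.
  apply: ge_ereal_sup => _ [[k l] [/= Ck Dl] <-]; rewrite hE jE.
  by apply: leeD; apply: ereal_sup_ubound; [exists k|exists l].
have [k0 [k0p _]] := interior_base bC (@filterT _ (nbhs p) _).
have [l0 [l0p _]] := interior_base bD (@filterT _ (nbhs p.2) _).
rewrite hE; apply: ereal_supD_le => //; first by exists k0.
  by apply: (@lt_le_trans _ _ (n w)%:E); [exact: ltNyr|exact: jnw].
move=> k kp; rewrite addeC jE; apply: ereal_supD_le => //; first by exists l0.
move=> l lp; rewrite addeC; apply: ereal_sup_ubound.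
by exists (k, l).
Qed.

End dependence.

(** * Extension from a generating pi-system to all Borel sets *)

Section monotone_class.
Context {R : realType} {d : measure_display} {Om : measurableType d}
  (P : probability Om R).
Variable F : set (set Om).
Hypothesis sF : sigma_algebra setT F.
Hypothesis Fm : F `<=` measurable.
Local Open Scope ereal_scope.
Variables (E E' : ptopologicalType) (xi : Om -> E) (theta : Om -> E').
Hypothesis mxi : measurable_fun setT (xi : Om -> borel E).
Hypothesis mtheta : rv_measurable F theta.

Let factors (B : set E) := exists zeta : E' -> \bar R,
    measurable_fun setT (zeta : borel E' -> \bar R) /\
    nncondexp P F (fun w => (\1_B (xi w))%:E) (fun w => zeta (theta w)).

Let mindic (B : set E) : borel_sets B ->
  measurable_fun setT (fun w => (\1_B (xi w))%:E : \bar R).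
Proof.
move=> mB; apply/measurable_EFinP.
have m1 : measurable_fun setT (\1_B : borel E -> R) by exact: measurable_indic.
exact: (measurableT_comp m1 mxi).
Qed.

Lemma nncondexp_cst (r : R) : (0 <= r)%R ->
  nncondexp P F (fun=> r%:E) (fun=> r%:E).
Proof. by move=> r0; split. Qed.

(** Almost surely zB <= zA <= 1, so the versions can be subtracted; truncation at 0 gives the sign
    everywhere. The integrals are compared after adding the finite integral of zB to both sides. *)
Let factors_setD (A B : set E) : borel_sets A -> borel_sets B -> B `<=` A ->
  factors A -> factors B -> factors (A `\` B).
Proof.
move=> mA mB BA [zA [mzA cA]] [zB [mzB cB]].
exists (fun e => maxe 0 (zA e - zB e)); split.
  by apply: measurable_maxe => //; exact: emeasurable_funB.
have mAB : borel_sets (A `\` B) by exact: (@measurableD _ (borel E)).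
have zBA : {ae P, forall w, zB (theta w) <= zA (theta w)}.
  apply: (nncondexp_le sF Fm cB cA); apply: aeW => w.
  rewrite lee_fin !indicE ler_nat.
  by case: (boolP (xi w \in B)) => // /set_mem/BA/mem_set ->.
have zA1 : {ae P, forall w, zA (theta w) <= 1}.
  apply: (nncondexp_le sF Fm cA (nncondexp_cst ler01)); apply: aeW => w.
  by rewrite lee_fin indicE; case: (_ \in _).
have [mYA mZA YA0 ZA0 YZA] := cA.
have [mYB mZB YB0 ZB0 YZB] := cB.
have mZ : measurable_fun setT ((fun w => maxe 0 (zA (theta w) - zB (theta w)))
    : g_sigma_algebraType F -> \bar R).
  apply: measurable_maxe => //; exact: emeasurable_funB.
split => //.
- exact: mindic.
- by move=> w; rewrite le_max lexx.
move=> S FS; have mS := Fm FS.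
have finB : \int[P]_(w in S) zB (theta w) \is a fin_num.
  rewrite YZB// ge0_fin_numE; last exact: integral_ge0.
  apply: (@le_lt_trans _ _ (\int[P]_(w in S) 1)).
    apply: ge0_le_integral => //; first exact: measurable_funTS.
    by move=> w _; rewrite lee_fin indicE; case: (_ \in _).
  by rewrite integral_cst// mul1e ltey_eq fin_num_measure.
rewrite -[LHS](addeK _ finB) -[RHS](addeK _ finB); congr (_ - _).
rewrite -ge0_integralD//; last 3 first.
- by move=> w _; rewrite le_max lexx.
- exact/measurable_funTS/(measurable_fun_sub sF Fm mZ).
- exact/measurable_funTS/(measurable_fun_sub sF Fm mZB).
rewrite YZB// -ge0_integralD//; last 2 first.
- exact/measurable_funTS/mindic.
- exact: measurable_funTS.
transitivity (\int[P]_(w in S) zA (theta w)).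
  apply: ae_eq_integral => //.
  - apply/measurable_funTS/emeasurable_funD; last exact: measurable_fun_sub mZB.
    exact: measurable_fun_sub mZ.
  - exact/measurable_funTS/(measurable_fun_sub sF Fm mZA).
  apply: filterS2 zBA zA1 => w zBA1 zA11 _.
  have zBfin : zB (theta w) \is a fin_num.
    rewrite ge0_fin_numE//; apply: le_lt_trans zBA1 _.
    by apply: le_lt_trans zA11 _; rewrite ltry.
  by rewrite max_r ?sube_ge0 ?zBfin ?orbT// subeK.
rewrite YZA//; apply: eq_integral => w _; rewrite -EFinD !indicE; congr _%:E.
rewrite in_setD; have [/set_mem/BA/mem_set ->|] := boolP (xi w \in B).
  by rewrite andbF add0r.
by rewrite andbT addr0.
Qed.

(** The sets that factor form a lambda-system: proper differences by [factors_setD], increasing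
    unions by conditional monotone convergence. *)
Lemma condexp_factors_generated (G : set (set E)) :
  setI_closed G -> G `<=` @borel_sets E -> @borel_sets E `<=` <<s G >> ->
  (forall B, G B -> factors B) -> condexp_factors P F xi theta.
Proof.
move=> GI Gb bG Gf.
have lam : lambda_system setT [set B | borel_sets B /\ factors B].
  split => //=.
  - split; first exact: (@measurableT _ (borel E)).
    exists (cst 1); split => //.
    rewrite (_ : (fun w => _) = cst 1%:E); first exact: (nncondexp_cst ler01).
    by apply/funext => w; rewrite indicE in_setT.
  - move=> A B BA [mA fA] [mB fB]; split; last exact: factors_setD.
    exact: (@measurableD _ (borel E)).
  - move=> A ndA mfA; split.
      by apply: (@bigcupT_measurable _ (borel E)) => n; case: (mfA n).
    have [zeta zetaP] := choice (fun n => (mfA n).2).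
    exists (fun e => ereal_sup (range (zeta ^~ e))); split.
      by apply: (@measurable_sup _ (borel E')) => n; case: (zetaP n).
    have := nncondexp_sup sF Fm (fun n => (zetaP n).2).
    have nd w : nondecreasing_seq (fun n => (\1_(A n) (xi w))%:E : \bar R).
      move=> m n mn; rewrite lee_fin !indicE ler_nat.
      have /subsetPset Amn := ndA _ _ mn.
      by case: (boolP (xi w \in A m)) => // /set_mem/Amn/mem_set ->.
    move=> /(_ nd); congr (nncondexp P F _ _); apply/funext => w.
    have sup_le1 : ereal_sup (range (fun n => (\1_(A n) (xi w))%:E : \bar R)) <= 1.
      apply: ge_ereal_sup => _ [n _ <-]; rewrite lee_fin indicE.
      by case: (_ \in _).
    rewrite [in RHS]indicE; apply/eqP; rewrite eq_le.
    have [/set_mem[n _ An]|xA] := boolP (xi w \in \bigcup_n A n).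
      rewrite sup_le1/=; apply: ereal_sup_ubound; exists n => //.
      by rewrite indicE (mem_set An).
    apply/andP; split.
      apply: ge_ereal_sup => _ [n _ <-]; rewrite indicE.
      case: (boolP (xi w \in A n)) => // /set_mem An; case/negP: xA.
      by apply/mem_set; exists n.
    by apply: ereal_sup_ubound; exists 0%N => //; rewrite indicE;
      case: (boolP (xi w \in A 0%N)) => // /set_mem An; case/negP: xA;
      apply/mem_set; exists 0%N.
move=> B /bG GB.
by have [] := lambda_system_subset GI lam
  (fun A GA => conj (Gb A GA) (Gf A GA)) (fun A _ => @subsetT _ A) GB.
Qed.

End monotone_class.

(** * Conditional laws from independence and the Markov property *)

Section markov.
Context {R : realType} {d : measure_display} {Om : measurableType d}
  (P : probability Om R).
Variable F : set (set Om).
Hypothesis sF : sigma_algebra setT F.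
Hypothesis Fm : F `<=` measurable.
Local Open Scope ereal_scope.

(** The version is the constant P(xi in B). *)
Lemma condexp_factors_independent (E E' : ptopologicalType) (xi : Om -> E)
    (theta : Om -> E') :
  measurable_fun setT (xi : Om -> borel E) -> independent P (sigma_of xi) F ->
  condexp_factors P F xi theta.
Proof.
move=> mxi ind B mB.
have mD : measurable (xi @^-1` B).
  by rewrite -[X in measurable X]setTI; exact: mxi.
exists (cst (P (xi @^-1` B))); split => //; split => //.
- apply/measurable_EFinP.
  have m1 : measurable_fun setT (\1_B : borel E -> R) by exact: measurable_indic.
  exact: (measurableT_comp m1 mxi).
move=> A FA; have mA := Fm FA.
rewrite integral_cst//.
transitivity (P (xi @^-1` B `&` A)).
  rewrite ind//; exists B => //; exact: setTI.
by rewrite -integral_indic.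
Qed.

Definition rectangles (E1 E2 E3 : topologicalType) : set (set (E1 * E2 * E3)) :=
  [set B | exists A1 A2 A3, [/\ borel_sets A1, borel_sets A2, borel_sets A3 &
    B = A1 `*` A2 `*` A3]].

Lemma rectangles_setI (E1 E2 E3 : ptopologicalType) :
  setI_closed (@rectangles E1 E2 E3).
Proof.
move=> _ _ [A1 [A2 [A3 [m1 m2 m3 ->]]]] [B1 [B2 [B3 [n1 n2 n3 ->]]]].
exists (A1 `&` B1), (A2 `&` B2), (A3 `&` B3); split.
- exact: (@measurableI _ (borel E1)).
- exact: (@measurableI _ (borel E2)).
- exact: (@measurableI _ (borel E3)).
by rewrite !setXI.
Qed.

Lemma rectangles_borel (E1 E2 E3 : ptopologicalType) :
  @rectangles E1 E2 E3 `<=` @borel_sets _.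
Proof.
move=> _ [A1 [A2 [A3 [m1 m2 m3 ->]]]].
have cont_fst (U V : topologicalType) : continuous (@fst U V).
  by move=> p; exact: cvg_fst.
have cont_snd (U V : topologicalType) : continuous (@snd U V).
  by move=> p; exact: cvg_snd.
have m (E' : ptopologicalType) (f : E1 * E2 * E3 -> E') A : continuous f ->
    borel_sets A -> borel_sets (f @^-1` A).
  move=> cf mA; rewrite -[f @^-1` A]setTI.
  exact: (@continuous_borel (E1 * E2 * E3)%type E' f cf measurableT A mA).
rewrite (_ : _ `*` _ = (fst \o fst) @^-1` A1 `&` (snd \o fst) @^-1` A2 `&`
    snd @^-1` A3)//.
have m11 : continuous (fst \o fst : E1 * E2 * E3 -> E1).
  by move=> p; apply: continuous_comp; exact: cont_fst.
have m12 : continuous (snd \o fst : E1 * E2 * E3 -> E2).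
  by move=> p; apply: continuous_comp; [exact: cont_fst|exact: cont_snd].
apply: (@measurableI _ (borel (E1 * E2 * E3)%type)).
  apply: (@measurableI _ (borel (E1 * E2 * E3)%type)).
    exact: (m _ _ _ m11 m1).
  exact: (m _ _ _ m12 m2).
exact: (m _ snd _ (cont_snd _ _) m3).
Qed.

(** The three coordinates are measurable for the sigma-algebra generated by the rectangles, hence so
    is the identity, as a triple of them, into the Borel sigma-algebra. *)
Lemma borel_rectangles (E1 E2 E3 : ptopologicalType)
    (C1 : nat -> set E1) (C2 : nat -> set E2) (C3 : nat -> set E3) :
  compact_base C1 -> compact_base C2 -> compact_base C3 ->
  @borel_sets (E1 * E2 * E3)%type `<=` <<s @rectangles E1 E2 E3 >>.
Proof.
move=> b1 b2 b3 B mB.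
have [C12 b12] := compact_base_prod b1 b2.
pose T := g_sigma_algebraType (@rectangles E1 E2 E3).
have p1 : measurable_fun setT ((fun w => w.1.1) : T -> borel E1).
  move=> _ A mA; rewrite setTI; apply: sub_sigma_algebra.
  exists A, setT, setT; split => //; try exact: measurableT.
    exact: (@measurableT _ (borel E2)).
    exact: (@measurableT _ (borel E3)).
  by apply/seteqP; split => -[[x y] z] //= -[[]].
have p2 : measurable_fun setT ((fun w => w.1.2) : T -> borel E2).
  move=> _ A mA; rewrite setTI; apply: sub_sigma_algebra.
  exists setT, A, setT; split => //.
    exact: (@measurableT _ (borel E1)).
    exact: (@measurableT _ (borel E3)).
  by apply/seteqP; split => -[[x y] z] //= -[[]].
have p3 : measurable_fun setT ((fun w => w.2) : T -> borel E3).
  move=> _ A mA; rewrite setTI; apply: sub_sigma_algebra.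
  exists setT, setT, A; split => //.
    exact: (@measurableT _ (borel E1)).
    exact: (@measurableT _ (borel E2)).
  by apply/seteqP; split => -[[x y] z] //= -[[]].
have := measurable_borel_pair b12 b3 (measurable_borel_pair b1 b2 p1 p2) p3.
move=> /(_ measurableT B mB); rewrite setTI.
by congr (<<s _ >> _); apply/seteqP; split => -[[x y] z].
Qed.

(** On a rectangle the version is P(eta in A3) 1_A1(theta) P(theta' in A2 | theta): [theta] is known
    to [F], the Markov property treats A2, and the independence of [eta] from [F] and [theta']
    jointly splits off A3. *)
Lemma condexp_factors_markov (E1 E2 E3 : ptopologicalType)
    (C1 : nat -> set E1) (C2 : nat -> set E2) (C3 : nat -> set E3)
    (S : set (set Om)) (theta : Om -> E1) (theta' : Om -> E2) (eta : Om -> E3) :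
  compact_base C1 -> compact_base C2 -> compact_base C3 ->
  rv_measurable F theta ->
  measurable_fun setT (theta' : Om -> borel E2) ->
  measurable_fun setT (eta : Om -> borel E3) ->
  (forall B, borel_sets B -> exists Z : Om -> \bar R,
    is_condexp P (sigma_of theta) (EFin \o \1_(theta' @^-1` B)) Z /\
    is_condexp P F (EFin \o \1_(theta' @^-1` B)) Z) ->
  sigma_of theta' `<=` S ->
  independent P (sigma_of eta) (sigma_join F S) ->
  condexp_factors P F (fun w => (theta w, theta' w, eta w)) theta.
Proof.
move=> b1 b2 b3 mth mth' meta markov thS ind.
have mth1 : measurable_fun setT (theta : Om -> borel E1) := measurable_fun_sub sF Fm mth.
have [C12 b12] := compact_base_prod b1 b2.
have mpair := measurable_borel_pair b12 b3 (measurable_borel_pair b1 b2 mth1 mth') meta.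
apply: (condexp_factors_generated sF Fm mpair (@rectangles_setI E1 E2 E3)
  (@rectangles_borel E1 E2 E3) (borel_rectangles b1 b2 b3)).
move=> _ [A1 [A2 [A3 [m1 m2 m3 ->]]]].
have [Z [[mZ _] ZF]] := markov A2 m2.
have [zeta [mzeta Zzeta]] := sigma_of_factor mZ.
have mD2 : measurable (theta' @^-1` A2).
  by rewrite -[X in measurable X]setTI; exact: mth'.
have mD3 : measurable (eta @^-1` A3).
  by rewrite -[X in measurable X]setTI; exact: meta.
have FD1 : F (theta @^-1` A1).
  by rewrite -(measurable_sigmaE sF) -[X in measurable X]setTI; exact: mth.
have mI2 : measurable_fun setT (EFin \o \1_(theta' @^-1` A2) : Om -> \bar R).
  by apply/measurable_EFinP; exact: measurable_indic.
have c0 : nncondexp P F (EFin \o (fun=> 0%R)) (EFin \o (fun=> 0%R)).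
  by split => //; exact: measurable_cst.
have i0 : \int[P]_w (0%R : R)%:E < +oo by rewrite integral0.
have n0 : {ae P, forall w, - (0%R : R)%:E <= (EFin \o \1_(theta' @^-1` A2)) w}.
  by apply: aeW => w; rewrite /= oppr0 lee_fin.
(* The version given by the Markov property may be negative on a null set; the zero shift replaces
   it by its positive part. *)
have [c2 _] := condexp_nncondexp sF Fm ZF mI2 c0 i0 n0.
pose p := fine (P (eta @^-1` A3)).
have pE : p%:E = P (eta @^-1` A3) by rewrite fineK// fin_num_measure.
have m1' : measurable_fun setT (\1_A1 : borel E1 -> R) by exact: measurable_indic.
have mz : measurable_fun setT
    ((fun e => (\1_A1 e)%:E * maxe 0 (zeta e)) : borel E1 -> \bar R).
  apply: emeasurable_funM; first exact/measurable_EFinP.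
  exact: measurable_maxe.
exists (fun e => p%:E * ((\1_A1 e)%:E * maxe 0 (zeta e))); split.
  exact: measurable_funeM.
have p0 : (0 <= p)%R by rewrite fine_ge0.
have z0 e : 0 <= (\1_A1 e)%:E * maxe 0 (zeta e).
  by rewrite mule_ge0 ?lee_fin// le_max lexx.
split.
- apply/measurable_EFinP.
  have mr : borel_sets (A1 `*` A2 `*` A3).
    by apply: rectangles_borel; exists A1, A2, A3.
  have mir : measurable_fun setT
      (\1_(A1 `*` A2 `*` A3) : borel (E1 * E2 * E3)%type -> R).
    exact: measurable_indic.
  exact: (measurableT_comp mir mpair).
- exact: (measurableT_comp (measurable_funeM p%:E mz) mth).
- by move=> w; rewrite lee_fin.
- by move=> w; rewrite mule_ge0.
move=> A FA; have mA := Fm FA.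
have FAD : F (A `&` theta @^-1` A1).
  by rewrite -(measurable_sigmaE sF); apply: measurableI; rewrite (measurable_sigmaE sF).
have mAD := Fm FAD.
rewrite ge0_integralZl//; last first.
  exact/measurable_funTS/(measurableT_comp mz mth1).
have -> : \int[P]_(w in A) ((\1_A1 (theta w))%:E * maxe 0 (zeta (theta w))) =
    P (theta' @^-1` A2 `&` (A `&` theta @^-1` A1)).
  have [_ _ _ _ /(_ _ FAD) c2AD] := c2.
  rewrite -integral_indic//.
  transitivity (\int[P]_(w in A `&` theta @^-1` A1) maxe 0 (Z w + 0%:E)).
    rewrite integral_mkcondr epatch_indic; apply: eq_integral => w _ /=.
    by rewrite adde0 Zzeta muleC.
  rewrite c2AD; apply: eq_integral => w _.
  by rewrite adde0 max_r// lee_fin.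
rewrite pE.
transitivity (P (eta @^-1` A3 `&` (theta' @^-1` A2 `&` (A `&` theta @^-1` A1)))).
  have ia : sigma_of eta (eta @^-1` A3) by exists A3 => //; rewrite setTI.
  rewrite (ind _ _ ia)//.
  apply: (@measurableI _ (g_sigma_algebraType (F `|` S))).
    by apply: sub_sigma_algebra; right; apply: thS; exists A2 => //; rewrite setTI.
  by apply: sub_sigma_algebra; left.
rewrite (_ : _ `&` _ =
  (eta @^-1` A3 `&` theta' @^-1` A2 `&` theta @^-1` A1) `&` A); last first.
  by rewrite !setIA [in RHS]setIAC.
rewrite -integral_indic//; last first.
  by apply: measurableI; [exact: measurableI|exact: (Fm FD1)].
apply: eq_integral => w _; congr _%:E; rewrite !indicE; congr (nat_of_bool _)%:R.
apply/idP/idP => /set_mem H; apply/mem_set.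
  by case: H => -[? ?] ?.
by case: H => -[/= ? ?] ?.
Qed.

End markov.

(** * Bellman equations *)

Section bellman_step.
Context {R : realType} {d : measure_display} {Om : measurableType d}
  (P : probability Om R).
Local Open Scope ereal_scope.

Lemma depends_only_through_ae {V : normedModType R} (E : topologicalType)
    (h j : V -> Om -> \bar R) (xi : Om -> E) :
  {ae P, forall w, forall x, j x w = h x w} ->
  depends_only_through P h xi -> depends_only_through P j xi.
Proof.
move=> jh [H [HN hH]]; exists H; split => //.
by apply: filterS2 jh hH => w jhw hHw x; rewrite jhw.
Qed.

(** Determinism becomes dependence on a constant with values in the zero-dimensional space, so that
    both claims of the theorem go through the same induction. *)
Lemma deterministicP {V : normedModType R} (h : V -> Om -> \bar R) :
  (forall w, closed (epi (h ^~ w))) ->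
  deterministic P h <->
  depends_only_through P h (fun=> 0%R : 'rV[R]_0).
Proof.
move=> ch; split=> [[h0 hh0]|[H [_ hH]]]; last by exists (H ^~ 0%R).
(* Since P has mass one, [h0] coincides with [h] at some sample point, from which it inherits a
   closed epigraph. *)
have [w0 hw0] : exists w0, forall x, h x w0 = h0 x.
  apply: contrapT => /forallNP nh.
  have [N [mN PN0 hN]] := hh0.
  have /eqP : P setT = 0.
    apply/eqP; rewrite eq_le measure_ge0 andbT -PN0 le_measure ?inE//.
    by move=> w _; apply: hN; exact: nh.
  by rewrite probability_setT onee_eq0.
have ch0 : closed (epi h0).
  by rewrite (_ : h0 = h ^~ w0)//; apply/funext => x; rewrite hw0.
exists (fun x _ => h0 x); split => //; split => // O oO.
have [h0O|h0O] := pselect (epi h0 `&` O !=set0).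
  by rewrite (_ : [set _ | _] = setT);
    [exact: (@measurableT _ (borel 'rV[R]_0))|apply/seteqP; split].
by rewrite (_ : [set _ | _] = set0);
  [exact: (@measurable0 _ (borel 'rV[R]_0))|apply/seteqP; split].
Qed.

Variables (F : set (set Om)) (N M : nat).
Hypothesis sF : sigma_algebra setT F.
Hypothesis Fm : F `<=` measurable.
Variables (E E' : ptopologicalType) (xi : Om -> E) (theta : Om -> E').
Hypothesis mxi : measurable_fun setT (xi : Om -> borel E).
Hypothesis mtheta : rv_measurable F theta.
Hypothesis cf : condexp_factors P F xi theta.

(** Dependence on [xi] passes through the sum and the infimum over y, becomes dependence on [theta]
    under conditioning, and passes through the infimum over u. Both variables stay abstract, to
    serve the Markov case as well as the case of noise alone. *)
Lemma bellman_step (K : 'rV[R]_N * 'rV[R]_M * 'rV[R]_N -> Om -> \bar R)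
    (J0 J1 : 'rV[R]_N -> Om -> \bar R)
    (Q EQ : 'rV[R]_N * 'rV[R]_M -> Om -> \bar R) :
  lower_bounded P K -> lower_bounded P J1 ->
  normal_integrand measurable Q -> lower_bounded P Q ->
  (forall w, closed (epi (J0 ^~ w))) ->
  is_cond_integrand P F Q EQ ->
  {ae P, forall w, forall x u, Q (x, u) w =
    ereal_inf [set K (x, u, y) w + J1 y w | y in setT]} ->
  {ae P, forall w, forall x, J0 x w = ereal_inf [set EQ (x, u) w | u in setT]} ->
  depends_only_through P K xi -> depends_only_through P J1 xi ->
  depends_only_through P J0 theta.
Proof.
move=> lbK lbJ1 QN lbQ cJ0 cEQ QE J0E dK dJ1.
have [CN bN] := compact_base_rV R N.
have [CM bM] := compact_base_rV R M.
have [CZ bZ] := compact_base_prod bN bM.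
have [CY bY] := compact_base_prod bZ bN.
have dQ : depends_only_through P Q xi.
  apply: (depends_only_through_inf bZ
    (depends_only_through_add bY bN dK dJ1 lbK lbJ1) QN.1).
  by apply: filterS QE => w QEw [x u]; exact: QEw.
have dEQ := cond_integrand_depends bZ sF Fm mxi mtheta cf QN lbQ dQ cEQ.
exact: (depends_only_through_inf bN dEQ cJ0).
Qed.

End bellman_step.

Lemma backward_induction (T : nat) (A : nat -> Prop) :
  A T -> (forall t, (t < T)%N -> A t.+1 -> A t) -> forall t, (t <= T)%N -> A t.
Proof.
move=> AT Astep t tT; rewrite -(subKn tT).
elim: (T - t)%N (leq_subr t T) => [|k IH] kT; first by rewrite subn0.
apply: Astep; first by rewrite ltn_subrL (leq_ltn_trans _ kT).
by rewrite -subSn// subSS; apply: IH; exact: ltnW.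
Qed.

Theorem theorem11 (R : realType) (d : measure_display) (Om : measurableType d)
    (P : probability Om R) (T N M : nat) (F : nat -> set (set Om))
    (K : nat -> 'rV[R]_N * 'rV[R]_M * 'rV[R]_N -> Om -> \bar R)
    (J : 'rV[R]_N -> Om -> \bar R)
    (Jv : nat -> 'rV[R]_N -> Om -> \bar R)
    (Q : nat -> 'rV[R]_N * 'rV[R]_M -> Om -> \bar R)
    (dim_theta dim_eta : nat -> nat)
    (theta : forall t : nat, Om -> 'rV[R]_(dim_theta t))
    (eta : forall t : nat, Om -> 'rV[R]_(dim_eta t))
    (F_filtration : filtration T F)
    (F0_trivial : forall A, F 0%N A -> P A = 0%E \/ P A = 1%E)
    (K_normal : forall t, (0 < t)%N -> (t <= T)%N ->
       lb_convex_normal P (F t) (K t))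
    (J_normal : lb_convex_normal P (F T) J)
    (JQ_solution : bellman_solution P T F K J Jv Q)
    (theta_markov : adapted_markov P T F theta)
    (eta_adapted : adapted T F eta)
    (eta_indep : forall t, (t <= T)%N ->
       independent P (sigma_of (eta t))
         (sigma_join (sigma_process T setT theta)
                     (sigma_process T [set s | s != t] eta)))
    (eta_innovations : innovations P T F theta eta)
    (K_depends : forall t, (0 < t)%N -> (t <= T)%N ->
       depends_only_through P (K t)
         (fun w => (theta t.-1 w, theta t w, eta t w))) :
  (depends_only_through P J (theta T) ->
   forall t, (t <= T)%N -> depends_only_through P (Jv t) (theta t)) /\
  ((forall t, (0 < t)%N -> (t <= T)%N -> depends_only_through P (K t) (eta t)) ->
   deterministic P J ->
   forall t, (t <= T)%N -> deterministic P (Jv t)).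
Proof.
have [sF Fm F_mono] := F_filtration.
have [JvN QN [EQ [cEQ JQE]]] := JQ_solution.
have [theta_adapted markov] := theta_markov.
have JvT : {ae P, forall w, forall x, Jv T x w = J x w}.
  by apply: filterS JQE => w [].
have QE t : (t < T)%N -> {ae P, forall w, forall x u, Q t (x, u) w =
    ereal_inf [set (K t.+1 (x, u, y) w + Jv t.+1 y w)%E | y in setT]}.
  by move=> tT; apply: filterS JQE => w [_ /(_ t tT)[]].
have JE t : (t < T)%N -> {ae P, forall w, forall x,
    Jv t x w = ereal_inf [set EQ t (x, u) w | u in setT]}.
  by move=> tT; apply: filterS JQE => w [_ /(_ t tT)[]].
have mtheta t : (t <= T)%N ->
    measurable_fun setT (theta t : Om -> borel 'rV[R]_(dim_theta t)).
  by move=> tT; exact: (measurable_fun_sub (sF t tT) (Fm t tT) (theta_adapted t tT)).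
have meta t : (t <= T)%N ->
    measurable_fun setT (eta t : Om -> borel 'rV[R]_(dim_eta t)).
  by move=> tT; exact: (measurable_fun_sub (sF t tT) (Fm t tT) (eta_adapted t tT)).
have step t (E E' : ptopologicalType) (xi : Om -> E) (th : Om -> E') :
    (t < T)%N -> measurable_fun setT (xi : Om -> borel E) ->
    rv_measurable (F t) th -> condexp_factors P (F t) xi th ->
    depends_only_through P (K t.+1) xi ->
    depends_only_through P (Jv t.+1) xi -> depends_only_through P (Jv t) th.
  move=> tT mxi mth cf; apply: (bellman_step (sF t (ltnW tT)) (Fm t (ltnW tT))
    mxi mth cf _ _ _ _ _ (cEQ t tT) (QE t tT) (JE t tT)).
  - by case: (K_normal t.+1 (ltn0Sn t) tT).
  - by case: (JvN t.+1 tT).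
  - by case: (QN t tT).
  - by case: (QN t tT).
  - by case: (JvN t (ltnW tT)) => -[].
split=> [dJ|dK /deterministicP dJ].
  apply: backward_induction; first exact: depends_only_through_ae JvT dJ.
  move=> t tT dJv.
  have tT' := ltnW tT.
  have [C1 b1] := compact_base_rV R (dim_theta t).
  have [C2 b2] := compact_base_rV R (dim_theta t.+1).
  have [C3 b3] := compact_base_rV R (dim_eta t.+1).
  have [C12 b12] := compact_base_prod b1 b2.
  (* The triple carries what the next cost depends on, and its middle coordinate what the next value
     function depends on. *)
  apply: (step t _ _ (fun w => (theta t w, theta t.+1 w, eta t.+1 w))) => //.
  - apply: (measurable_borel_pair b12 b3 _ (meta t.+1 tT)).
    exact: (measurable_borel_pair b1 b2 (mtheta t tT') (mtheta t.+1 tT)).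
  - exact: theta_adapted.
  - apply: (condexp_factors_markov (sF t tT') (Fm t tT') b1 b2 b3
      (theta_adapted t tT') (mtheta t.+1 tT) (meta t.+1 tT) (markov t tT) _
      (eta_innovations t tT)).
    by move=> A sA; apply: sub_sigma_algebra; exists t.+1.
  - exact: (K_depends t.+1).
  - apply: (@depends_only_through_comp _ _ _ P _
      ('rV[R]_(dim_theta t) * 'rV[R]_(dim_theta t.+1) * 'rV[R]_(dim_eta t.+1))%type
      _ _ (fun p => p.1.2) (fun w => (theta t w, theta t.+1 w, eta t.+1 w)) _ dJv).
    by move=> p; apply: continuous_comp; [exact: cvg_fst|exact: cvg_snd].
move=> t tT; apply/deterministicP; first by case: (JvN t tT) => -[].
move: t tT; apply: backward_induction.
  apply: depends_only_through_ae JvT (dJ _).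
  by case: J_normal => -[].
(* Here [xi] is the noise alone, independent of [F t], and the conditioning variable is the
   constant; the next value function depends on the noise through a constant map. *)
move=> t tT dJv; apply: (step t _ _ (eta t.+1)) => //.
- exact: meta.
- exact: measurable_cst.
- apply: (condexp_factors_independent (Fm t (ltnW tT)) _ (meta t.+1 tT)).
  move=> A B sA FB; apply: (eta_innovations t tT) => //.
  by apply: sub_sigma_algebra; left.
- exact: dK.
- apply: (@depends_only_through_comp _ _ _ P _ _ _ _ (fun=> 0) (eta t.+1) _ dJv).
  exact: cst_continuous.
Qed.
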